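(* (A) For any non-constant locally uniformly recurrent entire function $F$, \[ \liminf_{R\to\infty}\frac{\log\log M_F(R)}{R}>0 . \] (B) There exists a non-constant locally uniformly recurrent entire function $F$ such that \[ \limsup_{R\to\infty}\frac{\log\log M_F(R)}{R}<\infty . \]
   Context: For an entire function $F$, $M_F(R)=\max_{|z|\le R}|F(z)|$ and $(\tau_wF)(z)=F(z+w)$ for $w\in\mathbb C$. A set $W\subset\mathbb C$ is relatively dense if there is a radius $r_0$ such that every disk of radius at least $r_0$ contains at least one point of $W$. An entire function $F$ is locally uniformly recurrent if for every $\varepsilon>0$ and every compact set $K\subset\mathbb C$ the set $\{w\in\mathbb C\colon \max_K|\tau_wF-F|<\varepsilon\}$ is relatively dense in $\mathbb C$. *)

(* Defs.v *)
From Stdlib Require Import Reals List.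
From Coquelicot Require Export Coquelicot.
Open Scope R_scope.

Definition entire (F : C -> C) : Prop :=
  forall z : C, ex_derive (K := C_AbsRing) (V := C_NormedModule) F z.

Definition non_constant (F : C -> C) : Prop :=
  ~ exists c : C, forall z : C, F z = c.

Definition compact_set {T : UniformSpace} (K : T -> Prop) : Prop :=
  forall (I : Type) (U : I -> T -> Prop),
    (forall i, open (U i)) ->
    (forall x, K x -> exists i, U i x) ->
    exists l : list I, forall x, K x -> exists i, In i l /\ U i x.

(* For continuous F and nonempty compact K the supremum is attained and this is
   max_K |F|.  The value is 0 for empty K: Lub_Rbar is then m_infty, which the
   coercion to R sends to 0. *)
Definition max_on (K : C -> Prop) (F : C -> C) : R :=
  Lub_Rbar (fun y : R => exists z : C, K z /\ y = Cmod (F z)).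

Definition closed_disk (c : C) (r : R) (z : C) : Prop :=
  Cmod (z - c)%C <= r.

Definition max_modulus (F : C -> C) (r : R) : R :=
  max_on (closed_disk 0%C r) F.

Definition translate (w : C) (F : C -> C) (z : C) : C := F (z + w)%C.

Definition relatively_dense (W : C -> Prop) : Prop :=
  exists r0 : R, 0 < r0 /\
    forall (c : C) (r : R), r0 <= r -> exists w : C, W w /\ closed_disk c r w.

Definition locally_uniformly_recurrent (F : C -> C) : Prop :=
  forall (eps : R) (K : C -> Prop), 0 < eps -> compact_set K ->
    relatively_dense
      (fun w : C => max_on K (fun z => (translate w F z - F z)%C) < eps).

(* Lower and upper limits of f(t) as t -> +oo, namely
   sup_r inf_{t > r} f(t) and inf_r sup_{t > r} f(t). *)
Definition LimInf_infty (f : R -> R) : Rbar :=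
  Rbar_lub (fun y : Rbar => exists r : R,
    y = Glb_Rbar (fun x : R => exists t : R, r < t /\ x = f t)).

Definition LimSup_infty (f : R -> R) : Rbar :=
  Rbar_glb (fun y : Rbar => exists r : R,
    y = Lub_Rbar (fun x : R => exists t : R, r < t /\ x = f t)).

(* ln vanishes on nonpositive arguments; this is immaterial for the limits at
   infinity, since the maximum modulus of a non-constant entire function is
   unbounded. *)
Definition loglog_rate (F : C -> C) (r : R) : R :=
  ln (ln (max_modulus F r)) / r.

(* Main.v *)
Require Import Defs.
From Stdlib Require Import Reals Lra Lia ZArith Classical ClassicalEpsilon.
From Coquelicot Require Import Coquelicot.
Open Scope R_scope.

(** A recurrent entire function grows at least doubly exponentially.  On the unit disk [F]
    is bounded by some [A]; by recurrence it is bounded by [A + 1] on a unit disk around the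
    points of a relatively dense set, so within a fixed distance [r0] of any point.  If such
    a disk lies near [z] and [M] is the maximum of [|F|] on a somewhat larger disk around
    it, then [|F z|] is at most a constant times [M ^ theta] with [theta < 1], as in
    Hadamard's three circles theorem ([three_circles]).  Hence [m = ln (max_modulus F)]
    satisfies [m rho <= c + theta * m (rho + s)] ([log_max_modulus_contraction]).  It is
    unbounded by [liouville], so up to a constant it eventually increases by a factor at
    each step of length [s] ([recurrent_growth_lower_bound]).

    An example of this growth is built by copying.  For each level [k] the plane carries a
    grid of mesh [4 * 3 ^ k], whose cells contain squares separated by gaps of width 2; nine
    cells make up a cell of the next level.  [tower (S k)] approximates on each of nine
    squares the translate of [tower k] to this square: it is the sum of these translates,
    each one multiplied by a polynomial close to 1 on its square and close to 0 on the other
    squares ([bump_grid], [tower_copy]).  The limit [F] approximates [tower k] on all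
    translates of the square of level [k] by the nodes of the grid ([limit_translate], by
    balanced ternary expansion of the indices), and therefore recurs.

    The polynomials must separate long rectangles with a gap of width 2, at the price of a
    logarithm that is exponential in their length, which is the growth allowed.  They are
    derived from [z / sqrt (z ^ 2)], the sign of the real part, by continuation:
    [1 / sqrt (z ^ 2 + T ^ 2)] is almost constant for large [T], and as [T] decreases by
    steps of fixed length one step of Newton's method, a polynomial operation, repairs the
    approximation after each move ([isqrt_err_le]).  The degree triples each time, and the
    number of steps is proportional to the size of the squares.

    Both parts rest on Cauchy's formula for functions that are only assumed to be
    differentiable at each point ([goursat], [cauchy_formula]); contours are boundaries of
    rectangles.  Its other consequences are Taylor expansions with explicit remainder
    ([taylor_remainder]) and the differentiability of locally uniform limits
    ([weierstrass]). *)

(** * Complex differentiability *)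

(** The derivative with [Cmod] in place of filters; [ex_derive_cdiff] makes the
    connection. *)
Definition cdiff (F : C -> C) (z : C) : Prop :=
  exists l : C, forall eps, 0 < eps -> exists delta, 0 < delta /\
    forall y : C, Cmod (y - z) < delta ->
      Cmod (F y - F z - l * (y - z)) <= eps * Cmod (y - z).

Definition ccont (F : C -> C) (z : C) : Prop :=
  forall eps, 0 < eps -> exists delta, 0 < delta /\
    forall y : C, Cmod (y - z) < delta -> Cmod (F y - F z) < eps.

Lemma ex_derive_cdiff (F : C -> C) (z : C) :
  ex_derive (K := C_AbsRing) (V := C_NormedModule) F z <-> cdiff F z.
Proof.
  split.
  - intros [l [_ H]]. exists l. intros eps He.
    assert (Hz : is_filter_lim (locally (T := AbsRing_UniformSpace C_AbsRing) z) z)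
      by (intros P HP; exact HP).
    destruct (H z Hz (mkposreal eps He)) as [d Hd].
    exists d. split; [apply cond_pos|]. intros y Hy.
    specialize (Hd y Hy). simpl in Hd.
    unfold norm, minus, plus, opp, scal in Hd; simpl in Hd.
    unfold mult in Hd; simpl in Hd.
    replace (F y - F z - l * (y - z))%C with (F y + - F z + - ((y + - z) * l))%C
      by ring.
    exact Hd.
  - intros [l H]. exists l. split.
    + apply is_linear_scal_l.
    + intros x Hx eps.
      assert (x = z).
      { symmetry. apply is_filter_lim_locally_unique. exact Hx. }
      subst x.
      destruct (H eps (cond_pos eps)) as [d [Hd0 Hd]].
      exists (mkposreal d Hd0). intros y Hy. specialize (Hd y Hy).
      unfold norm, minus, plus, opp, scal; simpl.
      unfold mult; simpl.
      replace (F y + - F z + - ((y + - z) * l))%C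
        with (F y - F z - l * (y - z))%C by ring.
      exact Hd.
Qed.

Lemma Cmod_triangle_minus (x y : C) : Cmod (x - y) <= Cmod x + Cmod y.
Proof.
  unfold Cminus. rewrite <- (Cmod_opp y). apply Cmod_triangle.
Qed.

Lemma Cmod_minus_sym (x y : C) : Cmod (x - y) = Cmod (y - x).
Proof. rewrite <- Cmod_opp. f_equal. ring. Qed.

Lemma Cmod_triangle_rev (x y : C) : Cmod x - Cmod y <= Cmod (x + y).
Proof.
  assert (H := Cmod_triangle_minus (x + y) y).
  replace (x + y - y)%C with x in H by ring. lra.
Qed.

Lemma cdiff_ccont (F : C -> C) (z : C) : cdiff F z -> ccont F z.
Proof.
  intros [l H] eps He.
  destruct (H 1 Rlt_0_1) as [d [Hd0 Hd]].
  assert (Hl := Cmod_ge_0 l).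
  exists (Rmin d (eps / (2 + Cmod l))).
  assert (H1 : 0 < eps / (2 + Cmod l)) by (apply Rdiv_lt_0_compat; lra).
  split; [now apply Rmin_pos|].
  intros y Hy.
  assert (Hy1 := Rlt_le_trans _ _ _ Hy (Rmin_l _ _)).
  assert (Hy2 := Rlt_le_trans _ _ _ Hy (Rmin_r _ _)).
  specialize (Hd y Hy1).
  assert (H2 := Cmod_triangle (F y - F z - l * (y - z)) (l * (y - z))).
  replace (F y - F z - l * (y - z) + l * (y - z))%C with (F y - F z)%C in H2 by ring.
  rewrite Cmod_mult in H2.
  assert (H3 : Cmod (y - z) * (2 + Cmod l) < eps).
  { apply (Rmult_lt_compat_r (2 + Cmod l)) in Hy2; [|lra].
    replace (eps / (2 + Cmod l) * (2 + Cmod l)) with eps in Hy2 by (field; lra).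
    exact Hy2. }
  assert (H4 := Cmod_ge_0 (y - z)).
  nra.
Qed.

Lemma cdiff_const (c z : C) : cdiff (fun _ => c) z.
Proof.
  exists 0%C. intros eps He. exists 1. split; [lra|]. intros y _. cbv beta.
  replace (c - c - 0 * (y - z))%C with (RtoC 0) by ring.
  rewrite Cmod_0. apply Rmult_le_pos; [lra | apply Cmod_ge_0].
Qed.

Lemma cdiff_id (z : C) : cdiff (fun y => y) z.
Proof.
  exists 1%C. intros eps He. exists 1. split; [lra|]. intros y _. cbv beta.
  replace (y - z - 1 * (y - z))%C with (RtoC 0) by ring.
  rewrite Cmod_0. apply Rmult_le_pos; [lra | apply Cmod_ge_0].
Qed.

Lemma cdiff_plus (F G : C -> C) (z : C) :
  cdiff F z -> cdiff G z -> cdiff (fun y => (F y + G y)%C) z.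
Proof.
  intros [l HF] [m HG]. exists (l + m)%C. intros eps He.
  assert (He2 : 0 < eps / 2) by lra.
  destruct (HF _ He2) as [d [Hd0 Hd]]. destruct (HG _ He2) as [e [He0 He']].
  exists (Rmin d e). split; [now apply Rmin_pos|]. intros y Hy.
  specialize (Hd y (Rlt_le_trans _ _ _ Hy (Rmin_l _ _))).
  specialize (He' y (Rlt_le_trans _ _ _ Hy (Rmin_r _ _))).
  replace (F y + G y - (F z + G z) - (l + m) * (y - z))%C with
    ((F y - F z - l * (y - z)) + (G y - G z - m * (y - z)))%C by ring.
  eapply Rle_trans; [apply Cmod_triangle|]. lra.
Qed.

Lemma cdiff_mult (F G : C -> C) (z : C) :
  cdiff F z -> cdiff G z -> cdiff (fun y => (F y * G y)%C) z.
Proof.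
  intros HF HG. assert (HGc := cdiff_ccont G z HG).
  destruct HF as [l HF]; destruct HG as [m HG].
  exists (l * G z + F z * m)%C. intros eps He.
  set (B := 1 + Cmod (F z) + Cmod (G z) + Cmod l).
  assert (P1 := Cmod_ge_0 (F z)). assert (P2 := Cmod_ge_0 (G z)).
  assert (P3 := Cmod_ge_0 l).
  assert (HB : 1 <= B) by (unfold B; lra).
  assert (HeB : 0 < eps / (3 * B)) by (apply Rdiv_lt_0_compat; lra).
  destruct (HF _ HeB) as [d1 [Hd10 Hd1]].
  destruct (HG _ HeB) as [d2 [Hd20 Hd2]].
  destruct (HGc _ HeB) as [d3 [Hd30 Hd3]].
  destruct (HGc 1 Rlt_0_1) as [d4 [Hd40 Hd4]].
  exists (Rmin (Rmin d1 d2) (Rmin d3 d4)).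
  split; [repeat apply Rmin_pos; assumption|]. intros y Hy.
  assert (Hy1 := Rlt_le_trans _ _ _ Hy (Rmin_l _ _)).
  assert (Hy2 := Rlt_le_trans _ _ _ Hy (Rmin_r _ _)).
  specialize (Hd1 y (Rlt_le_trans _ _ _ Hy1 (Rmin_l _ _))).
  specialize (Hd2 y (Rlt_le_trans _ _ _ Hy1 (Rmin_r _ _))).
  specialize (Hd3 y (Rlt_le_trans _ _ _ Hy2 (Rmin_l _ _))).
  specialize (Hd4 y (Rlt_le_trans _ _ _ Hy2 (Rmin_r _ _))).
  replace (F y * G y - F z * G z - (l * G z + F z * m) * (y - z))%C with
    ((F y - F z - l * (y - z)) * G y + (F z * (G y - G z - m * (y - z))
       + l * (y - z) * (G y - G z)))%C by ring.
  assert (HGy : Cmod (G y) <= B).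
  { assert (H := Cmod_triangle (G y - G z) (G z)).
    replace (G y - G z + G z)%C with (G y) in H by ring. unfold B. lra. }
  eapply Rle_trans; [apply Cmod_triangle|].
  eapply Rle_trans; [apply Rplus_le_compat_l, Cmod_triangle|].
  rewrite !Cmod_mult.
  assert (Hq : eps / (3 * B) * B = eps / 3) by (field; lra).
  set (q := eps / (3 * B)) in *.
  set (t := Cmod (y - z)) in *. assert (Ht : 0 <= t) by apply Cmod_ge_0.
  assert (Q1 : Cmod (F y - F z - l * (y - z)) * Cmod (G y) <= q * t * B).
  { apply Rmult_le_compat; try apply Cmod_ge_0; assumption. }
  assert (Q2 : Cmod (F z) * Cmod (G y - G z - m * (y - z)) <= B * (q * t)).
  { apply Rmult_le_compat; try apply Cmod_ge_0; [unfold B; lra | assumption]. }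
  assert (Q3 : Cmod l * t * Cmod (G y - G z) <= B * t * q).
  { apply Rmult_le_compat; try apply Cmod_ge_0; [nra | | lra].
    apply Rmult_le_compat_r; [lra | unfold B; lra]. }
  replace (q * t * B) with (eps / 3 * t) in Q1 by (rewrite <- Hq; ring).
  replace (B * (q * t)) with (eps / 3 * t) in Q2 by (rewrite <- Hq; ring).
  replace (B * t * q) with (eps / 3 * t) in Q3 by (rewrite <- Hq; ring).
  lra.
Qed.

Lemma cdiff_affine (F : C -> C) (a b z : C) :
  cdiff F (a * z + b)%C -> cdiff (fun y => F (a * y + b)%C) z.
Proof.
  intros [l HF]. exists (l * a)%C. intros eps He.
  assert (Pa := Cmod_ge_0 a).
  assert (HeB : 0 < eps / (1 + Cmod a)) by (apply Rdiv_lt_0_compat; lra).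
  destruct (HF _ HeB) as [d [Hd0 Hd]].
  exists (d / (1 + Cmod a)). split; [apply Rdiv_lt_0_compat; lra|].
  intros y Hy.
  apply (Rmult_lt_compat_r (1 + Cmod a)) in Hy; [|lra].
  replace (d / (1 + Cmod a) * (1 + Cmod a)) with d in Hy by (field; lra).
  assert (Py := Cmod_ge_0 (y - z)).
  assert (E : (a * y + b - (a * z + b) = a * (y - z))%C) by ring.
  specialize (Hd (a * y + b)%C). rewrite E, Cmod_mult in Hd.
  replace (F (a * y + b) - F (a * z + b) - l * a * (y - z))%C with
    (F (a * y + b) - F (a * z + b) - l * (a * (y - z)))%C by ring.
  eapply Rle_trans; [apply Hd; nra|].
  replace (eps * Cmod (y - z)) with
    (eps / (1 + Cmod a) * ((1 + Cmod a) * Cmod (y - z))) by (field; lra).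
  apply Rmult_le_compat_l; nra.
Qed.

Lemma cdiff_inv (h z : C) : z <> h -> cdiff (fun y => (/ (y - h))%C) z.
Proof.
  intros Hz.
  assert (Hzh : (z - h)%C <> 0%C).
  { intros H. apply Hz. replace z with ((z - h) + h)%C by ring. rewrite H. ring. }
  assert (P : 0 < Cmod (z - h)) by now apply Cmod_gt_0.
  set (r := Cmod (z - h)) in *.
  exists (- (/ ((z - h) * (z - h))))%C. intros eps He.
  exists (Rmin (r / 2) (eps * r * r * (r / 2))).
  split.
  { apply Rmin_pos; [lra|]. repeat apply Rmult_lt_0_compat; lra. }
  intros y Hy.
  assert (Hy1 := Rlt_le_trans _ _ _ Hy (Rmin_l _ _)).
  assert (Hy2 := Rlt_le_trans _ _ _ Hy (Rmin_r _ _)).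
  assert (Hr : r / 2 <= Cmod (y - h)).
  { assert (H := Cmod_triangle_rev (z - h) (y - z)).
    replace (z - h + (y - z))%C with (y - h)%C in H by ring. fold r in H. lra. }
  assert (Hyh : (y - h)%C <> 0%C) by (apply Cmod_gt_0; lra).
  replace (/ (y - h) - / (z - h) - - / ((z - h) * (z - h)) * (y - z))%C with
    ((y - z) * (y - z) * / ((z - h) * (z - h) * (y - h)))%C
    by (field; split; assumption).
  assert (Hne : ((z - h) * (z - h) * (y - h))%C <> 0%C)
    by (repeat apply Cmult_neq_0; assumption).
  rewrite !Cmod_mult, Cmod_inv, !Cmod_mult by assumption. fold r.
  set (t := Cmod (y - z)) in *. assert (Ht : 0 <= t) by apply Cmod_ge_0.
  assert (Hk : 0 < r * r * Cmod (y - h)) by (repeat apply Rmult_lt_0_compat; lra).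
  apply (Rmult_le_reg_r (r * r * Cmod (y - h))); [assumption|].
  replace (t * t * / (r * r * Cmod (y - h)) * (r * r * Cmod (y - h)))
    with (t * t) by (field; split; lra).
  assert (eps * r * r * (r / 2) <= eps * r * r * Cmod (y - h)).
  { apply Rmult_le_compat_l; [|assumption].
    apply Rlt_le; repeat apply Rmult_lt_0_compat; lra. }
  assert (t <= eps * r * r * Cmod (y - h)) by lra.
  nra.
Qed.

Lemma cdiff_div (F : C -> C) (h z : C) :
  z <> h -> cdiff F z -> cdiff (fun y => (F y / (y - h))%C) z.
Proof.
  intros Hz HF. apply cdiff_mult; [assumption | now apply cdiff_inv].
Qed.

Lemma cdiff_opp (F : C -> C) (z : C) : cdiff F z -> cdiff (fun y => (- F y)%C) z.
Proof.
  intros [l HF]. exists (- l)%C. intros eps He.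
  destruct (HF _ He) as [d [Hd0 Hd]]. exists d. split; [assumption|].
  intros y Hy. specialize (Hd y Hy).
  replace (- F y - - F z - - l * (y - z))%C with
    (- (F y - F z - l * (y - z)))%C by ring.
  now rewrite Cmod_opp.
Qed.

Lemma cdiff_minus (F G : C -> C) (z : C) :
  cdiff F z -> cdiff G z -> cdiff (fun y => (F y - G y)%C) z.
Proof.
  intros HF HG. apply cdiff_plus; [assumption | now apply cdiff_opp].
Qed.

Lemma cdiff_ext (F G : C -> C) (z : C) :
  (forall y, F y = G y) -> cdiff F z -> cdiff G z.
Proof.
  intros E [l HF]. exists l. intros eps He.
  destruct (HF _ He) as [d [Hd0 Hd]]. exists d. split; [assumption|].
  intros y Hy. rewrite <- !E. now apply Hd.
Qed.

Lemma cdiff_pow (F : C -> C) (n : nat) (z : C) :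
  cdiff F z -> cdiff (fun y => (F y ^ n)%C) z.
Proof.
  intros HF. induction n as [|n IH].
  - apply (cdiff_ext (fun _ => RtoC 1)); [reflexivity | apply cdiff_const].
  - now apply (cdiff_mult F (fun y => (F y ^ n)%C)).
Qed.

Lemma ccont_plus (F G : C -> C) (z : C) :
  ccont F z -> ccont G z -> ccont (fun y => (F y + G y)%C) z.
Proof.
  intros HF HG e He.
  destruct (HF (e / 2)) as [d1 [? Hd1]]; [lra|].
  destruct (HG (e / 2)) as [d2 [? Hd2]]; [lra|].
  exists (Rmin d1 d2). split; [now apply Rmin_pos|]. intros w Hw.
  specialize (Hd1 w (Rlt_le_trans _ _ _ Hw (Rmin_l _ _))).
  specialize (Hd2 w (Rlt_le_trans _ _ _ Hw (Rmin_r _ _))).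
  replace (F w + G w - (F z + G z))%C with ((F w - F z) + (G w - G z))%C by ring.
  eapply Rle_lt_trans; [apply Cmod_triangle|]. lra.
Qed.

Lemma ccont_mult (F G : C -> C) (z : C) :
  ccont F z -> ccont G z -> ccont (fun y => (F y * G y)%C) z.
Proof.
  intros HF HG e He.
  assert (P1 := Cmod_ge_0 (F z)). assert (P2 := Cmod_ge_0 (G z)).
  set (B := 1 + Cmod (F z) + Cmod (G z)).
  assert (HB : 1 <= B) by (unfold B; lra).
  assert (He2 : 0 < e / (3 * B)) by (apply Rdiv_lt_0_compat; lra).
  destruct (HF _ He2) as [d1 [? Hd1]].
  destruct (HG _ He2) as [d2 [? Hd2]].
  destruct (HG 1 Rlt_0_1) as [d3 [? Hd3]].
  exists (Rmin (Rmin d1 d2) d3). split; [repeat apply Rmin_pos; assumption|].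
  intros w Hw.
  assert (Hw1 := Rlt_le_trans _ _ _ Hw (Rmin_l _ _)).
  specialize (Hd1 w (Rlt_le_trans _ _ _ Hw1 (Rmin_l _ _))).
  specialize (Hd2 w (Rlt_le_trans _ _ _ Hw1 (Rmin_r _ _))).
  specialize (Hd3 w (Rlt_le_trans _ _ _ Hw (Rmin_r _ _))).
  replace (F w * G w - F z * G z)%C with
    ((F w - F z) * G w + F z * (G w - G z))%C by ring.
  assert (HGw : Cmod (G w) <= B).
  { assert (H2 := Cmod_triangle (G w - G z) (G z)).
    replace (G w - G z + G z)%C with (G w) in H2 by ring. unfold B. lra. }
  eapply Rle_lt_trans; [apply Cmod_triangle|]. rewrite !Cmod_mult.
  assert (Hq : e / (3 * B) * B = e / 3) by (field; lra).
  assert (Q1 : Cmod (F w - F z) * Cmod (G w) <= e / (3 * B) * B)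
    by (apply Rmult_le_compat; try apply Cmod_ge_0; lra).
  assert (Q2 : Cmod (F z) * Cmod (G w - G z) <= B * (e / (3 * B)))
    by (apply Rmult_le_compat; try apply Cmod_ge_0; unfold B in *; lra).
  lra.
Qed.

(** * Integrals of complex functions along the sides of rectangles *)

Notation CInt := (RInt (V := C_R_CompleteNormedModule)).
Notation ex_CInt := (ex_RInt (V := C_R_NormedModule)).
Notation is_CInt := (is_RInt (V := C_R_NormedModule)).

(** The two sides are equal but not convertible: the norm of the product space squares
    the absolute values of the components. *)
Lemma norm_C_R (z : C) : norm (V := C_R_NormedModule) z = Cmod z.
Proof.
  destruct z as [x y]. unfold norm; simpl. unfold prod_norm, norm; simpl.
  unfold abs; simpl. unfold Cmod. simpl. f_equal.
  rewrite !Rmult_1_r, <- !Rabs_mult, !Rabs_pos_eq; [ring | nra | nra].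
Qed.

Lemma Cmod_Rabs_le (x y : R) : Cmod (x, y) <= Rabs x + Rabs y.
Proof.
  replace ((x, y) : C) with (RtoC x + Ci * RtoC y)%C
    by (apply injective_projections; simpl; ring).
  eapply Rle_trans; [apply Cmod_triangle|].
  rewrite Cmod_mult, Cmod_Ci, !Cmod_R. lra.
Qed.

Lemma Rabs_fst_le_Cmod (z : C) : Rabs (fst z) <= Cmod z.
Proof. eapply Rle_trans; [apply Rmax_l | apply Rmax_Cmod]. Qed.

Lemma Rabs_snd_le_Cmod (z : C) : Rabs (snd z) <= Cmod z.
Proof. eapply Rle_trans; [apply Rmax_r | apply Rmax_Cmod]. Qed.

Lemma continuous_path (f : R -> C) (t : R) :
  (forall eps, 0 < eps -> exists delta, 0 < delta /\
     forall s, Rabs (s - t) < delta -> Cmod (f s - f t) < eps) ->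
  continuous (U := C_R_NormedModule) f t.
Proof.
  intros H. apply filterlim_locally. intros eps.
  destruct (H eps (cond_pos eps)) as [d [Hd0 Hd]].
  exists (mkposreal d Hd0). intros s Hs. specialize (Hd s Hs).
  split.
  - eapply Rle_lt_trans; [|exact Hd].
    exact (Rabs_fst_le_Cmod (f s - f t)).
  - eapply Rle_lt_trans; [|exact Hd].
    exact (Rabs_snd_le_Cmod (f s - f t)).
Qed.

Lemma ccont_horizontal (f : C -> C) (x c : R) : ccont f (x, c) ->
  continuous (U := C_R_NormedModule) (fun t => f (t, c)) x.
Proof.
  intros H. apply continuous_path. intros eps He.
  destruct (H eps He) as [d [Hd0 Hd]]. exists d. split; [assumption|].
  intros s Hs. apply Hd.
  replace (Cminus _ _) with (RtoC (s - x))
    by (apply injective_projections; simpl; ring).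
  rewrite Cmod_R. exact Hs.
Qed.

Lemma ccont_vertical (f : C -> C) (a y : R) : ccont f (a, y) ->
  continuous (U := C_R_NormedModule) (fun t => f (a, t)) y.
Proof.
  intros H. apply continuous_path. intros eps He.
  destruct (H eps He) as [d [Hd0 Hd]]. exists d. split; [assumption|].
  intros s Hs. apply Hd.
  replace (Cminus _ _) with (Ci * RtoC (s - y))%C
    by (apply injective_projections; simpl; ring).
  now rewrite Cmod_mult, Cmod_Ci, Cmod_R, Rmult_1_l.
Qed.

Lemma is_CInt_ci (f : R -> C) (a b : R) (l : C) :
  is_CInt f a b l -> is_CInt (fun t => Ci * f t)%C a b (Ci * l)%C.
Proof.
  intros H.
  assert (H1 := is_RInt_fct_extend_fst (U := R_NormedModule) (V := R_NormedModule)
    f a b l H).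
  assert (H2 := is_RInt_fct_extend_snd (U := R_NormedModule) (V := R_NormedModule)
    f a b l H).
  replace (Ci * l)%C with ((- snd l, fst l) : C)
    by (apply injective_projections; simpl; ring).
  apply (is_RInt_fct_extend_pair (U := R_NormedModule) (V := R_NormedModule)).
  - apply (is_RInt_ext (fun t => opp (snd (f t)))).
    + intros x _. simpl. unfold opp; simpl. ring.
    + now apply (is_RInt_opp (V := R_NormedModule)).
  - apply (is_RInt_ext (fun t => fst (f t))); [|assumption].
    intros x _. simpl. ring.
Qed.

Lemma is_CInt_mult (f : R -> C) (a b : R) (k l : C) :
  is_CInt f a b l -> is_CInt (fun t => k * f t)%C a b (k * l)%C.
Proof.
  intros H.
  assert (H1 := is_RInt_scal (V := C_R_NormedModule) _ a b (fst k) _ H).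
  assert (H2 := is_RInt_scal (V := C_R_NormedModule) _ a b (snd k) _ (is_CInt_ci _ _ _ _ H)).
  assert (H3 := is_RInt_plus (V := C_R_NormedModule) _ _ _ _ _ _ H1 H2).
  replace (k * l)%C with
    (plus (G := C_R_NormedModule) (scal (V := C_R_NormedModule) (fst k) l)
       (scal (V := C_R_NormedModule) (snd k) (Ci * l)%C)).
  2:{ apply injective_projections; unfold plus, scal; simpl;
      unfold plus, scal; simpl; unfold mult; simpl; ring. }
  eapply is_RInt_ext; [|exact H3].
  intros t _. apply injective_projections; unfold plus, scal; simpl;
      unfold plus, scal; simpl; unfold mult; simpl; ring.
Qed.

Lemma CInt_mult (f : R -> C) (a b : R) (k : C) :
  ex_CInt f a b -> CInt (fun t => k * f t)%C a b = (k * CInt f a b)%C.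
Proof.
  intros H. apply is_RInt_unique, is_CInt_mult.
  now apply (RInt_correct (V := C_R_CompleteNormedModule)).
Qed.

Lemma CInt_plus (f g : R -> C) (a b : R) :
  ex_CInt f a b -> ex_CInt g a b ->
  CInt (fun t => f t + g t)%C a b = (CInt f a b + CInt g a b)%C.
Proof. exact (RInt_plus (V := C_R_CompleteNormedModule) f g a b). Qed.

Lemma CInt_Chasles (f : R -> C) (a b c : R) :
  ex_CInt f a b -> ex_CInt f b c -> CInt f a c = (CInt f a b + CInt f b c)%C.
Proof.
  intros H1 H2. symmetry.
  exact (RInt_Chasles (V := C_R_CompleteNormedModule) f a b c H1 H2).
Qed.

Lemma CInt_bound (f : R -> C) (a b M : R) : a <= b -> ex_CInt f a b ->
  (forall t, a <= t <= b -> Cmod (f t) <= M) -> Cmod (CInt f a b) <= (b - a) * M.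
Proof.
  intros Hab Hex HM. rewrite <- norm_C_R.
  apply (norm_RInt_le_const (V := C_R_NormedModule) f); [assumption | |].
  - intros x Hx. rewrite norm_C_R. now apply HM.
  - now apply (RInt_correct (V := C_R_CompleteNormedModule)).
Qed.

(** The integral of [f dz] along the boundary of the rectangle [a, b] x [c, d],
    counterclockwise from the corner [(a, c)]. *)
Definition rint (f : C -> C) (a b c d : R) : C :=
  (CInt (fun x => f (x, c)) a b + Ci * CInt (fun y => f (b, y)) c d
   - CInt (fun x => f (x, d)) a b - Ci * CInt (fun y => f (a, y)) c d)%C.

Definition on_boundary (a b c d : R) (z : C) : Prop :=
  a <= fst z <= b /\ c <= snd z <= d /\
  (fst z = a \/ fst z = b \/ snd z = c \/ snd z = d).

Lemma ex_CInt_horizontal (f : C -> C) (a b c : R) : a <= b ->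
  (forall x, a <= x <= b -> ccont f (x, c)) -> ex_CInt (fun x => f (x, c)) a b.
Proof.
  intros Hab H. apply (ex_RInt_continuous (V := C_R_CompleteNormedModule)).
  intros x Hx. rewrite Rmin_left, Rmax_right in Hx by assumption.
  now apply ccont_horizontal, H.
Qed.

Lemma ex_CInt_vertical (f : C -> C) (a c d : R) : c <= d ->
  (forall y, c <= y <= d -> ccont f (a, y)) -> ex_CInt (fun y => f (a, y)) c d.
Proof.
  intros Hab H. apply (ex_RInt_continuous (V := C_R_CompleteNormedModule)).
  intros x Hx. rewrite Rmin_left, Rmax_right in Hx by assumption.
  now apply ccont_vertical, H.
Qed.

Section Boundary.

Variables a b c d : R.
Hypotheses (Hab : a <= b) (Hcd : c <= d).

Lemma boundary_sides (P : C -> Prop) :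
  (forall z, on_boundary a b c d z -> P z) ->
  ((forall x, a <= x <= b -> P (x, c)) /\ (forall y, c <= y <= d -> P (b, y))) /\
  ((forall x, a <= x <= b -> P (x, d)) /\ (forall y, c <= y <= d -> P (a, y))).
Proof.
  intros H. repeat split; intros t Ht; apply H; unfold on_boundary; simpl;
    repeat split; auto; lra.
Qed.

Lemma boundary_ex_CInt (f : C -> C) :
  (forall z, on_boundary a b c d z -> ccont f z) ->
  (ex_CInt (fun x => f (x, c)) a b /\ ex_CInt (fun y => f (b, y)) c d) /\
  (ex_CInt (fun x => f (x, d)) a b /\ ex_CInt (fun y => f (a, y)) c d).
Proof.
  intros H. destruct (boundary_sides _ H) as [[H1 H2] [H3 H4]].
  split; split.
  - exact (ex_CInt_horizontal f a b c Hab H1).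
  - exact (ex_CInt_vertical f b c d Hcd H2).
  - exact (ex_CInt_horizontal f a b d Hab H3).
  - exact (ex_CInt_vertical f a c d Hcd H4).
Qed.

Lemma rint_mult (f : C -> C) (k : C) :
  (forall z, on_boundary a b c d z -> ccont f z) ->
  rint (fun z => k * f z)%C a b c d = (k * rint f a b c d)%C.
Proof.
  intros H. destruct (boundary_ex_CInt f H) as [[H1 H2] [H3 H4]].
  unfold rint. rewrite !CInt_mult by assumption. ring.
Qed.

Lemma rint_plus (f g : C -> C) :
  (forall z, on_boundary a b c d z -> ccont f z) ->
  (forall z, on_boundary a b c d z -> ccont g z) ->
  rint (fun z => f z + g z)%C a b c d = (rint f a b c d + rint g a b c d)%C.
Proof.
  intros Hf Hg. destruct (boundary_ex_CInt f Hf) as [[H1 H2] [H3 H4]].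
  destruct (boundary_ex_CInt g Hg) as [[G1 G2] [G3 G4]].
  unfold rint. rewrite !CInt_plus by assumption. ring.
Qed.

Lemma rint_ext (f g : C -> C) :
  (forall z, on_boundary a b c d z -> f z = g z) -> rint f a b c d = rint g a b c d.
Proof.
  intros H. destruct (boundary_sides _ H) as [[H1 H2] [H3 H4]].
  assert (E : forall (u v : R -> C) p q, p <= q ->
     (forall t, p <= t <= q -> u t = v t) -> CInt u p q = CInt v p q).
  { intros u v p q Hpq Huv. apply RInt_ext.
    intros x Hx. rewrite Rmin_left, Rmax_right in Hx by assumption.
    apply Huv. lra. }
  unfold rint.
  rewrite (E (fun x => f (x, c)) (fun x => g (x, c))) by assumption.
  rewrite (E (fun x => f (x, d)) (fun x => g (x, d))) by assumption.
  rewrite (E (fun x => f (a, x)) (fun x => g (a, x))) by assumption.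
  rewrite (E (fun x => f (b, x)) (fun x => g (b, x))) by assumption.
  reflexivity.
Qed.

Lemma rint_bound (f : C -> C) (M : R) :
  (forall z, on_boundary a b c d z -> ccont f z) ->
  (forall z, on_boundary a b c d z -> Cmod (f z) <= M) ->
  Cmod (rint f a b c d) <= 2 * ((b - a) + (d - c)) * M.
Proof.
  intros Hf HM. destruct (boundary_ex_CInt f Hf) as [[H1 H2] [H3 H4]].
  destruct (boundary_sides _ HM) as [[M1 M2] [M3 M4]].
  unfold rint.
  assert (B1 := CInt_bound _ _ _ _ Hab H1 M1).
  assert (B2 := CInt_bound _ _ _ _ Hcd H2 M2).
  assert (B3 := CInt_bound _ _ _ _ Hab H3 M3).
  assert (B4 := CInt_bound _ _ _ _ Hcd H4 M4).
  eapply Rle_trans; [apply Cmod_triangle_minus|].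
  eapply Rle_trans; [apply Rplus_le_compat_r, Cmod_triangle_minus|].
  eapply Rle_trans; [apply Rplus_le_compat_r, Rplus_le_compat_r, Cmod_triangle|].
  rewrite !Cmod_mult, Cmod_Ci. lra.
Qed.

(** The two integrals along the common side cancel, so only the sides that are cut
    have to be integrable. *)
Lemma rint_split_x (f : C -> C) (m : R) : a <= m <= b ->
  (forall x, a <= x <= b -> ccont f (x, c) /\ ccont f (x, d)) ->
  rint f a b c d = (rint f a m c d + rint f m b c d)%C.
Proof.
  intros Hm H. unfold rint.
  rewrite (CInt_Chasles (fun x => f (x, c)) a m b),
    (CInt_Chasles (fun x => f (x, d)) a m b);
    try (apply (ex_CInt_horizontal f); [lra | intros x Hx; apply H; lra]).
  ring.
Qed.

Lemma rint_split_y (f : C -> C) (m : R) : c <= m <= d ->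
  (forall y, c <= y <= d -> ccont f (a, y) /\ ccont f (b, y)) ->
  rint f a b c d = (rint f a b c m + rint f a b m d)%C.
Proof.
  intros Hm H. unfold rint.
  rewrite (CInt_Chasles (fun x => f (a, x)) c m d),
    (CInt_Chasles (fun x => f (b, x)) c m d);
    try (apply (ex_CInt_vertical f); [lra | intros x Hx; apply H; lra]).
  ring.
Qed.

Lemma is_CInt_affine (k l : C) (p q : R) :
  is_CInt (fun t => k + l * RtoC t)%C p q
    (k * RtoC (q - p) + l * RtoC ((q * q - p * p) / 2))%C.
Proof.
  assert (H1 := is_RInt_const (V := C_R_NormedModule) p q k).
  assert (H2 : is_CInt (fun t => RtoC t) p q (RtoC ((q * q - p * p) / 2))).
  { apply (is_RInt_fct_extend_pair (U := R_NormedModule) (V := R_NormedModule)).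
    - simpl. replace ((q * q - p * p) / 2) with (minus (q * q / 2) (p * p / 2))
        by (unfold minus, plus, opp; simpl; field).
      apply (is_RInt_derive (V := R_CompleteNormedModule)
        (fun t => t * t / 2) (fun t => t)).
      + intros x _. auto_derive; [trivial | field].
      + intros x _. apply continuous_id.
    - simpl. assert (H := is_RInt_const (V := R_NormedModule) p q 0).
      refine (eq_ind _ (is_RInt (V := R_NormedModule) (fun _ => 0) p q) H _ _).
      unfold scal; simpl; unfold mult; simpl; ring. }
  assert (H3 := is_RInt_plus (V := C_R_NormedModule) _ _ _ _ _ _ H1
    (is_CInt_mult _ _ _ l _ H2)).
  replace (k * RtoC (q - p) + l * RtoC ((q * q - p * p) / 2))%C with
    (plus (G := C_R_NormedModule) (scal (V := C_R_NormedModule) (q - p) k)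
       (l * RtoC ((q * q - p * p) / 2))%C).
  2:{ apply injective_projections; unfold plus, scal; simpl;
      unfold plus, scal; simpl; unfold mult; simpl; ring. }
  exact H3.
Qed.

(** An affine function has a primitive, so its integral along a closed path is zero; here
    the four sides are computed. *)
Lemma rint_affine (k l : C) : rint (fun z => k + l * z)%C a b c d = RtoC 0.
Proof.
  assert (Hh : forall y, CInt (fun x => k + l * (x, y))%C a b =
    ((k + l * (Ci * RtoC y)) * RtoC (b - a) + l * RtoC ((b * b - a * a) / 2))%C).
  { intros y. apply is_RInt_unique.
    eapply is_RInt_ext; [|apply is_CInt_affine].
    intros x _. apply injective_projections; simpl; ring. }
  assert (Hv : forall x, CInt (fun y => k + l * (x, y))%C c d =
    ((k + l * RtoC x) * RtoC (d - c) + (l * Ci) * RtoC ((d * d - c * c) / 2))%C).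
  { intros y. apply is_RInt_unique.
    eapply is_RInt_ext; [|apply is_CInt_affine].
    intros x _. apply injective_projections; simpl; ring. }
  unfold rint. rewrite !Hh, !Hv.
  apply injective_projections; simpl; field.
Qed.

End Boundary.

(** * Goursat's theorem *)

Lemma nested_intervals (a b : nat -> R) :
  (forall n, a n <= a (S n) /\ b (S n) <= b n /\ a n <= b n) ->
  exists x, forall n, a n <= x <= b n.
Proof.
  intros H.
  assert (Ha : forall n k, a n <= a (n + k)%nat).
  { intros n k. induction k as [|k IH]; [rewrite Nat.add_0_r; lra|].
    rewrite Nat.add_succ_r. destruct (H (n + k)%nat). lra. }
  assert (Hb : forall n k, b (n + k)%nat <= b n).
  { intros n k. induction k as [|k IH]; [rewrite Nat.add_0_r; lra|].
    rewrite Nat.add_succ_r. destruct (H (n + k)%nat). lra. }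
  assert (Hab : forall m n, a m <= b n).
  { intros m n. apply Rle_trans with (a (m + n)%nat); [apply Ha|].
    apply Rle_trans with (b (m + n)%nat); [apply H|].
    rewrite Nat.add_comm. apply Hb. }
  destruct (completeness (fun t => exists n, t = a n)) as [x [Hx1 Hx2]].
  - exists (b 0%nat). intros t [n ->]. apply Hab.
  - now exists (a 0%nat), 0%nat.
  - exists x. intros n. split.
    + apply Hx1. now exists n.
    + apply Hx2. intros t [m ->]. apply Hab.
Qed.

Lemma half_pow_small (L delta : R) : 0 < delta -> exists n, L * (1 / 2) ^ n < delta.
Proof.
  intros Hd.
  assert (HL : 0 < Rabs L + 1) by (assert (H := Rabs_pos L); lra).
  destruct (pow_lt_1_zero (1 / 2)) with (y := delta / (Rabs L + 1)) as [n Hn].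
  - rewrite Rabs_pos_eq; lra.
  - now apply Rdiv_lt_0_compat.
  - exists n. specialize (Hn n (le_n n)).
    rewrite Rabs_pos_eq in Hn by (apply pow_le; lra).
    apply (Rmult_lt_compat_r (Rabs L + 1)) in Hn; [|lra].
    unfold Rdiv in Hn at 2. rewrite Rmult_assoc, Rinv_l, Rmult_1_r in Hn by lra.
    assert (0 < (1 / 2) ^ n) by (apply pow_lt; lra).
    assert (H1 := Rle_abs L). nra.
Qed.

(** Bisection: if [P] failed on the whole rectangle, it would fail on one of the quarters,
    then on a quarter of that one, and these rectangles shrink to a point. *)
Lemma rectangle_bisection (P : R -> R -> R -> R -> Prop) (A B C D : R) :
  A <= B -> C <= D ->
  (forall a b c d, A <= a -> a <= b -> b <= B -> C <= c -> c <= d -> d <= D ->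
     P a ((a + b) / 2) c ((c + d) / 2) -> P ((a + b) / 2) b c ((c + d) / 2) ->
     P a ((a + b) / 2) ((c + d) / 2) d -> P ((a + b) / 2) b ((c + d) / 2) d ->
     P a b c d) ->
  (forall x y, A <= x <= B -> C <= y <= D -> exists delta, 0 < delta /\
     forall a b c d, A <= a <= x -> x <= b <= B -> C <= c <= y -> y <= d <= D ->
       b - a < delta -> d - c < delta -> P a b c d) ->
  P A B C D.
Proof.
  intros HAB HCD Hq Hloc. apply NNPP. intros HP.
  set (bad := fun q : (R * R) * (R * R) =>
    let '((a, b), (c, d)) := q in
    A <= a /\ a <= b /\ b <= B /\ C <= c /\ c <= d /\ d <= D /\ ~ P a b c d).
  assert (Hstep : forall q, bad q -> exists q', bad q' /\
    fst (fst q) <= fst (fst q') /\ snd (fst q') <= snd (fst q) /\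
    fst (snd q) <= fst (snd q') /\ snd (snd q') <= snd (snd q) /\
    snd (fst q') - fst (fst q') = (snd (fst q) - fst (fst q)) / 2 /\
    snd (snd q') - fst (snd q') = (snd (snd q) - fst (snd q)) / 2).
  { intros [[a b] [c d]] (H1 & H2 & H3 & H4 & H5 & H6 & H7). simpl.
    set (m := (a + b) / 2). set (n := (c + d) / 2).
    assert (Hm : a <= m <= b) by (unfold m; lra).
    assert (Hn : c <= n <= d) by (unfold n; lra).
    destruct (classic (P a m c n)) as [Q1|Q1];
    [destruct (classic (P m b c n)) as [Q2|Q2];
     [destruct (classic (P a m n d)) as [Q3|Q3];
      [destruct (classic (P m b n d)) as [Q4|Q4];
       [exfalso; apply H7, Hq; auto|] | ] | ] | ];
    [exists ((m, b), (n, d)) | exists ((a, m), (n, d)) | exists ((m, b), (c, n))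
    | exists ((a, m), (c, n))]; simpl;
    (split; [repeat split; auto; lra | repeat split; try lra; unfold m, n; field]). }
  (* Dependent choice: a sequence of bad rectangles, each a quarter of the previous one. *)
  set (T := {q | bad q}).
  set (next := fun q : T => let r := constructive_indefinite_description _
       (Hstep (proj1_sig q) (proj2_sig q)) in
     exist bad (proj1_sig r) (proj1 (proj2_sig r)) : T).
  assert (Hnext : forall q : T, let q0 := proj1_sig q in let q' := proj1_sig (next q) in
    fst (fst q0) <= fst (fst q') /\ snd (fst q') <= snd (fst q0) /\
    fst (snd q0) <= fst (snd q') /\ snd (snd q') <= snd (snd q0) /\
    snd (fst q') - fst (fst q') = (snd (fst q0) - fst (fst q0)) / 2 /\
    snd (snd q') - fst (snd q') = (snd (snd q0) - fst (snd q0)) / 2).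
  { intros q. exact (proj2 (proj2_sig (constructive_indefinite_description _
       (Hstep (proj1_sig q) (proj2_sig q))))). }
  assert (HT : bad ((A, B), (C, D))) by (simpl; repeat split; auto; lra).
  set (u := fun n => Nat.iter n next (exist bad _ HT : T)).
  set (a := fun n => fst (fst (proj1_sig (u n)))).
  set (b := fun n => snd (fst (proj1_sig (u n)))).
  set (c := fun n => fst (snd (proj1_sig (u n)))).
  set (d := fun n => snd (snd (proj1_sig (u n)))).
  assert (Hbad : forall n, A <= a n /\ a n <= b n /\ b n <= B /\ C <= c n /\
     c n <= d n /\ d n <= D /\ ~ P (a n) (b n) (c n) (d n)).
  { intros n. unfold a, b, c, d. destruct (u n) as [[[? ?] [? ?]] Hb]. exact Hb. }
  assert (Hu : forall n, a n <= a (S n) /\ b (S n) <= b n /\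
     c n <= c (S n) /\ d (S n) <= d n /\
     b (S n) - a (S n) = (b n - a n) / 2 /\ d (S n) - c (S n) = (d n - c n) / 2).
  { intros n. exact (Hnext (u n)). }
  assert (Hsize : forall n, b n - a n = (B - A) * (1 / 2) ^ n /\
     d n - c n = (D - C) * (1 / 2) ^ n).
  { induction n as [|n [IH1 IH2]].
    - unfold a, b, c, d; simpl. lra.
    - destruct (Hu n) as (_ & _ & _ & _ & E1 & E2). rewrite E1, E2, IH1, IH2.
      simpl. split; field. }
  destruct (nested_intervals a b) as [x Hx].
  { intros n. destruct (Hu n) as (? & ? & _), (Hbad n) as (_ & ? & _). auto. }
  destruct (nested_intervals c d) as [y Hy].
  { intros n. destruct (Hu n) as (_ & _ & ? & ? & _), (Hbad n) as (_ & _ & _ & _ & ? & _).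
    auto. }
  destruct (Hloc x y) as [delta [Hd0 Hd]].
  { exact (Hx 0%nat). }
  { exact (Hy 0%nat). }
  destruct (half_pow_small (Rmax (B - A) (D - C)) delta Hd0) as [n Hn].
  destruct (Hbad n) as (H1 & H2 & H3 & H4 & H5 & H6 & H7). apply H7.
  assert (Hp : 0 < (1 / 2) ^ n) by (apply pow_lt; lra).
  destruct (Hsize n) as [E1 E2].
  assert (M1 := Rmax_l (B - A) (D - C)). assert (M2 := Rmax_r (B - A) (D - C)).
  destruct (Hx n), (Hy n).
  apply Hd; try lra; [rewrite E1 | rewrite E2]; nra.
Qed.

Definition cdiff_on (f : C -> C) (a b c d : R) : Prop :=
  forall z : C, a <= fst z <= b -> c <= snd z <= d -> cdiff f z.

(** The bound [eps * ((b - a) + (d - c)) ^ 2] is inherited by a rectangle from its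
    quarters, and it holds near each point because [f] is there affine up to
    [eps * |z - z0|], while affine functions integrate to zero. *)
Theorem goursat (f : C -> C) (a b c d : R) : a <= b -> c <= d ->
  cdiff_on f a b c d -> rint f a b c d = RtoC 0.
Proof.
  intros Hab Hcd Hf.
  assert (Hc : forall x y, a <= x <= b -> c <= y <= d -> ccont f (x, y)).
  { intros x y Hx Hy. now apply cdiff_ccont, Hf. }
  assert (Hmain : forall eps, 0 < eps ->
     Cmod (rint f a b c d) <= eps * (((b - a) + (d - c)) * ((b - a) + (d - c)))).
  { intros eps He.
    apply (rectangle_bisection (fun a b c d =>
      Cmod (rint f a b c d) <= eps * (((b - a) + (d - c)) * ((b - a) + (d - c)))));
      [assumption | assumption | |].
    - intros a' b' c' d' H1 H2 H3 H4 H5 H6.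
      set (m := (a' + b') / 2). set (n := (c' + d') / 2).
      assert (Hm : a' <= m <= b') by (unfold m; lra).
      assert (Hn : c' <= n <= d') by (unfold n; lra).
      intros Q1 Q2 Q3 Q4.
      rewrite (rint_split_x _ _ _ _ f m)
        by (try assumption; intros x Hx; split; apply Hc; lra).
      rewrite (rint_split_y a' m c' d' f n), (rint_split_y m b' c' d' f n)
        by (try assumption; intros x Hx; split; apply Hc; lra).
      eapply Rle_trans; [apply Cmod_triangle|].
      eapply Rle_trans; [apply Rplus_le_compat; apply Cmod_triangle|].
      replace (m - a') with ((b' - a') / 2) in * by (unfold m; field).
      replace (b' - m) with ((b' - a') / 2) in * by (unfold m; field).
      replace (n - c') with ((d' - c') / 2) in * by (unfold n; field).
      replace (d' - n) with ((d' - c') / 2) in * by (unfold n; field).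
      lra.
    - intros x y Hx Hy.
      destruct (Hf (x, y)) as [l Hl]; [assumption | assumption |].
      destruct (Hl (eps / 2)) as [delta [Hd0 Hd]]; [lra|].
      exists (delta / 2). split; [lra|].
      intros a' b' c' d' Ha' Hb' Hc' Hd' Hs1 Hs2.
      (* [k + l * z] is the affine approximation of [f] at the point. *)
      set (k := (f (x, y) - l * (x, y))%C).
      set (g := fun z => (f z + - (1) * (k + l * z))%C).
      assert (Hfc : forall z, on_boundary a' b' c' d' z -> ccont f z).
      { intros [p q] [Hp [Hq _]]; simpl in *. apply Hc; lra. }
      assert (Haff : forall z, cdiff (fun z => k + l * z)%C z).
      { intros z. apply cdiff_plus; [apply cdiff_const|].
        apply (cdiff_mult (fun _ => l) (fun z => z)); [apply cdiff_const | apply cdiff_id]. }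
      assert (Haff' : forall z, cdiff (fun z => - (1) * (k + l * z))%C z).
      { intros z. apply (cdiff_mult (fun _ => - (1))%C (fun z => k + l * z)%C);
          [apply cdiff_const | apply Haff]. }
      assert (E : rint f a' b' c' d' = rint g a' b' c' d').
      { unfold g. rewrite rint_plus; try lra.
        - rewrite (rint_mult _ _ _ _) by (lra || (intros; apply cdiff_ccont, Haff)).
          rewrite rint_affine by lra. ring.
        - assumption.
        - intros z _. apply cdiff_ccont, Haff'. }
      rewrite E.
      set (s := (b' - a') + (d' - c')).
      replace (eps * (s * s)) with (2 * s * (eps / 2 * s)) by field.
      apply rint_bound; try lra.
      + intros z Hz. apply ccont_plus; [now apply Hfc | apply cdiff_ccont, Haff'].
      + intros [p q] [Hp [Hq _]]; simpl in Hp, Hq.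
        assert (Hzs : Cmod ((p, q) - (x, y)) <= s).
        { eapply Rle_trans; [apply (Cmod_Rabs_le (p - x) (q - y))|].
          unfold s. apply Rplus_le_compat; apply Rabs_le; lra. }
        unfold g, k.
        replace (f (p, q) + - (1) * (f (x, y) - l * (x, y) + l * (p, q)))%C
          with (f (p, q) - f (x, y) - l * ((p, q) - (x, y)))%C by ring.
        eapply Rle_trans; [apply Hd; unfold s in Hzs; lra|].
        apply Rmult_le_compat_l; lra. }
  apply Cmod_eq_0. apply Rle_antisym; [|apply Cmod_ge_0].
  apply Rnot_lt_le. intros Hpos.
  set (S := ((b - a) + (d - c)) * ((b - a) + (d - c))) in *.
  assert (HS : 0 <= S) by (unfold S; apply Rle_0_sqr).
  specialize (Hmain (Cmod (rint f a b c d) / (2 * (S + 1)))).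
  assert (HN : 0 < Cmod (rint f a b c d) / (2 * (S + 1)))
    by (apply Rdiv_lt_0_compat; lra).
  specialize (Hmain HN).
  replace (Cmod (rint f a b c d) / (2 * (S + 1)) * S) with
    (Cmod (rint f a b c d) / 2 - Cmod (rint f a b c d) / (2 * (S + 1))) in Hmain
    by (field; lra).
  lra.
Qed.

(** Around the inner rectangle the outer one consists of four rectangles that do not
    meet the hole. *)
Lemma rint_annulus (f : C -> C) (a b c d a' b' c' d' : R) :
  a <= a' -> a' <= b' -> b' <= b -> c <= c' -> c' <= d' -> d' <= d ->
  (forall z : C, a <= fst z <= b -> c <= snd z <= d ->
     ~ (a' < fst z < b' /\ c' < snd z < d') -> cdiff f z) ->
  rint f a b c d = rint f a' b' c' d'.
Proof.
  intros H1 H2 H3 H4 H5 H6 Hf.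
  assert (Hc : forall x y, a <= x <= b -> c <= y <= d ->
     ~ (a' < x < b' /\ c' < y < d') -> ccont f (x, y)).
  { intros x y Hx Hy Hn. now apply cdiff_ccont, Hf. }
  rewrite (rint_split_x a b c d f a') by (try lra; intros; split; apply Hc; lra).
  rewrite (rint_split_x a' b c d f b') by (try lra; intros; split; apply Hc; lra).
  rewrite (rint_split_y a' b' c d f c') by (try lra; intros; split; apply Hc; lra).
  rewrite (rint_split_y a' b' c' d f d') by (try lra; intros; split; apply Hc; lra).
  rewrite (goursat f a a' c d), (goursat f b' b c d), (goursat f a' b' c c'),
    (goursat f a' b' d' d); try lra; try (intros z Hz1 Hz2; apply Hf; lra).
  ring.
Qed.

(** * Cauchy's formula and Taylor expansions *)

(** One side of the integral of [1 / (z - h)] along a square centred at [h]; by symmetry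
    the four sides give the same value.  The primitive is the complex logarithm. *)
Lemma is_CInt_cauchy_side (u s : R) : 0 < s ->
  is_CInt (fun t => ((t - u) / ((t - u) ^ 2 + s ^ 2), s / ((t - u) ^ 2 + s ^ 2)))
    (u - s) (u + s) (0, PI / 2).
Proof.
  intros Hs.
  assert (Hpos : forall t, 0 < (t - u) ^ 2 + s ^ 2)
    by (intros t; assert (H := pow2_ge_0 (t - u)); nra).
  apply (is_RInt_fct_extend_pair (U := R_NormedModule) (V := R_NormedModule)); simpl fst;
    simpl snd.
  - replace 0 with (minus (1 / 2 * ln ((u + s - u) ^ 2 + s ^ 2))
      (1 / 2 * ln ((u - s - u) ^ 2 + s ^ 2))).
    2:{ unfold minus, plus, opp; simpl.
        replace ((u - s - u) * ((u - s - u) * 1)) with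
          ((u + s - u) * ((u + s - u) * 1)) by ring. ring. }
    apply (is_RInt_derive (V := R_CompleteNormedModule)
      (fun t => 1 / 2 * ln ((t - u) ^ 2 + s ^ 2))).
    + intros t _. assert (Ht := Hpos t). auto_derive; [simpl in *; lra|].
      field. simpl in *; lra.
    + intros t _. assert (Ht := Hpos t).
      apply (ex_derive_continuous (K := R_AbsRing) (V := R_NormedModule)).
      auto_derive. simpl in *; lra.
  - replace (PI / 2) with (minus (atan ((u + s - u) / s)) (atan ((u - s - u) / s))).
    2:{ unfold minus, plus, opp; simpl.
        replace ((u + s - u) / s) with 1 by (field; lra).
        replace ((u - s - u) / s) with (Ropp 1) by (field; lra).
        rewrite atan_opp, atan_1. field. }
    apply (is_RInt_derive (V := R_CompleteNormedModule) (fun t => atan ((t - u) / s))).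
    + intros t _. assert (Ht := Hpos t). auto_derive; [trivial|].
      field. simpl in *; split; lra.
    + intros t _. assert (Ht := Hpos t).
      apply (ex_derive_continuous (K := R_AbsRing) (V := R_NormedModule)).
      auto_derive. simpl in *; lra.
Qed.

(** [2 * PI * i]. *)
Definition kappa : C := (0, 2 * PI).

Lemma kappa_neq_0 : kappa <> RtoC 0.
Proof.
  intros H. apply (f_equal snd) in H. simpl in H. assert (P := PI_RGT_0). lra.
Qed.

Lemma Cmod_kappa_ge_1 : 1 <= Cmod kappa.
Proof.
  eapply Rle_trans; [|apply Rabs_snd_le_Cmod]. simpl.
  assert (P := PI2_1). rewrite Rabs_pos_eq; lra.
Qed.

Lemma Cmod_inv_kappa_le (z : C) : Cmod (/ kappa * z) <= Cmod z.
Proof.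
  rewrite Cmod_mult, Cmod_inv by apply kappa_neq_0.
  assert (K := Cmod_kappa_ge_1). assert (P := Cmod_ge_0 z).
  rewrite <- (Rmult_1_l (Cmod z)) at 2. apply Rmult_le_compat_r; [assumption|].
  rewrite <- Rinv_1. apply Rinv_le_contravar; lra.
Qed.

Lemma rint_cauchy_kernel (h : C) (s : R) : 0 < s ->
  rint (fun z => / (z - h))%C (fst h - s) (fst h + s) (snd h - s) (snd h + s) = kappa.
Proof.
  destruct h as [u v]. intros Hs. simpl fst; simpl snd.
  assert (Hpos : forall t, 0 < t ^ 2 + s ^ 2)
    by (intros t; assert (H := pow2_ge_0 t); nra).
  assert (S1 : CInt (fun x => (/ ((x, (v - s)%R) - (u, v)))%C) (u - s) (u + s) =
    (0, PI / 2)).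
  { apply is_RInt_unique. eapply is_RInt_ext; [|now apply is_CInt_cauchy_side].
    intros x _. assert (H := Hpos (x - u)).
    apply injective_projections; simpl in *; field; repeat split; nra. }
  assert (S2 : CInt (fun y => (/ (((u + s)%R, y) - (u, v)))%C) (v - s) (v + s) =
    (- Ci * (0, (PI / 2)%R))%C).
  { apply is_RInt_unique. eapply is_RInt_ext;
      [|apply is_CInt_mult; now apply is_CInt_cauchy_side].
    intros y _. assert (H := Hpos (y - v)).
    apply injective_projections; simpl in *; field; repeat split; nra. }
  assert (S3 : CInt (fun x => (/ ((x, (v + s)%R) - (u, v)))%C) (u - s) (u + s) =
    (0, - (PI / 2))).
  { apply is_RInt_unique.
    replace ((0, - (PI / 2)) : C) with (Cconj (0, PI / 2)) by reflexivity.
    apply (is_RInt_fct_extend_pair (U := R_NormedModule) (V := R_NormedModule)).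
    - eapply is_RInt_ext; [|exact (is_RInt_fct_extend_fst (U := R_NormedModule)
        (V := R_NormedModule) _ _ _ _ (is_CInt_cauchy_side u s Hs))].
      intros x _. assert (H := Hpos (x - u)). simpl in *. field; repeat split; nra.
    - apply (is_RInt_ext (fun t => opp (s / ((t - u) ^ 2 + s ^ 2)))).
      + intros x _. assert (H := Hpos (x - u)). unfold opp. simpl in *.
        field; repeat split; nra.
      + apply (is_RInt_opp (V := R_NormedModule)).
        exact (is_RInt_fct_extend_snd (U := R_NormedModule)
        (V := R_NormedModule) _ _ _ _ (is_CInt_cauchy_side u s Hs)). }
  assert (S4 : CInt (fun y => (/ (((u - s)%R, y) - (u, v)))%C) (v - s) (v + s) =
    (- Ci * (0, (- (PI / 2))%R))%C).
  { apply is_RInt_unique.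
    replace (- Ci * (0, (- (PI / 2))%R))%C with ((- (PI / 2), 0) : C)
      by (apply injective_projections; simpl; ring).
    apply (is_RInt_fct_extend_pair (U := R_NormedModule) (V := R_NormedModule)).
    - apply (is_RInt_ext (fun t => opp (s / ((t - v) ^ 2 + s ^ 2)))).
      + intros y _. assert (H := Hpos (y - v)). unfold opp. simpl in *.
        field; repeat split; nra.
      + apply (is_RInt_opp (V := R_NormedModule)).
        exact (is_RInt_fct_extend_snd (U := R_NormedModule)
        (V := R_NormedModule) _ _ _ _ (is_CInt_cauchy_side v s Hs)).
    - apply (is_RInt_ext (fun t => opp ((t - v) / ((t - v) ^ 2 + s ^ 2)))).
      + intros y _. assert (H := Hpos (y - v)). unfold opp. simpl in *.
        field; repeat split; nra.
      + replace 0 with (opp (0 : R)) by (unfold opp; simpl; ring).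
        apply (is_RInt_opp (V := R_NormedModule)).
        exact (is_RInt_fct_extend_fst (U := R_NormedModule)
        (V := R_NormedModule) _ _ _ _ (is_CInt_cauchy_side v s Hs)). }
  unfold rint. rewrite S1, S2, S3, S4.
  apply injective_projections; simpl; field.
Qed.

(** Squares are used as contours in the role of circles: no parametrization is needed, and
    Goursat's theorem applies as it is. *)
Definition sq_int (f : C -> C) (r : R) : C := rint f (- r) r (- r) r.

Lemma sq_boundary_Cmod (r : R) (z : C) : on_boundary (- r) r (- r) r z ->
  r <= Cmod z <= 2 * r.
Proof.
  intros (H1 & H2 & H3). split.
  - destruct H3 as [H3|[H3|[H3|H3]]].
    + eapply Rle_trans; [|apply Rabs_fst_le_Cmod].
      rewrite H3, Rabs_Ropp. apply Rle_abs.
    + eapply Rle_trans; [|apply Rabs_fst_le_Cmod]. rewrite H3. apply Rle_abs.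
    + eapply Rle_trans; [|apply Rabs_snd_le_Cmod].
      rewrite H3, Rabs_Ropp. apply Rle_abs.
    + eapply Rle_trans; [|apply Rabs_snd_le_Cmod]. rewrite H3. apply Rle_abs.
  - destruct z as [x y]. eapply Rle_trans; [apply Cmod_Rabs_le|]. simpl in *.
    apply Rabs_le in H1, H2. lra.
Qed.

Lemma Cminus_neq_0 (z h : C) : z <> h -> (z - h)%C <> RtoC 0.
Proof.
  intros Hz H. apply Hz. replace z with ((z - h) + h)%C by ring. rewrite H. ring.
Qed.

(** The contour shrinks to a small square around [h], where [F] is nearly constant. *)
Theorem cauchy_formula (F : C -> C) (r : R) (h : C) :
  (forall z, cdiff F z) -> 0 < r -> Cmod h <= r / 2 ->
  sq_int (fun z => F z / (z - h))%C r = (kappa * F h)%C.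
Proof.
  intros HF Hr Hh.
  assert (Hh1 : Rabs (fst h) <= r / 2)
    by (eapply Rle_trans; [apply Rabs_fst_le_Cmod | assumption]).
  assert (Hh2 : Rabs (snd h) <= r / 2)
    by (eapply Rle_trans; [apply Rabs_snd_le_Cmod | assumption]).
  apply Rabs_le_between in Hh1, Hh2.
  assert (Hneq : forall (z : C) s, 0 < s -> on_boundary (fst h - s) (fst h + s)
     (snd h - s) (snd h + s) z -> s <= Cmod (z - h)).
  { intros z s Hs (H1 & H2 & H3).
    assert (Hb : on_boundary (- s) s (- s) s (z - h)%C).
    { unfold on_boundary; simpl; repeat split; lra. }
    apply (sq_boundary_Cmod s) in Hb. lra. }
  set (D := (sq_int (fun z => F z / (z - h)) r - kappa * F h)%C).
  assert (HD : forall eps, 0 < eps -> Cmod D <= 8 * eps).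
  { intros eps He.
    destruct (cdiff_ccont F h (HF h) eps He) as [d [Hd0 Hd]].
    set (s := Rmin (r / 2) (d / 4)).
    assert (Hs0 : 0 < s) by (apply Rmin_pos; lra).
    assert (Hs1 : s <= r / 2) by apply Rmin_l.
    assert (Hs2 : s <= d / 4) by apply Rmin_r.
    assert (E : D = rint (fun z => (F z - F h) / (z - h))%C
      (fst h - s) (fst h + s) (snd h - s) (snd h + s)).
    { unfold D, sq_int.
      rewrite (rint_annulus _ (- r) r (- r) r (fst h - s) (fst h + s)
        (snd h - s) (snd h + s)) by
        (first [lra | intros z H1 H2 H3; apply cdiff_div;
           [intros ->; apply H3; lra | apply HF]]).
      rewrite <- (rint_cauchy_kernel h s Hs0).
      transitivity (rint (fun z => (F z - F h) / (z - h) + F h * / (z - h))%C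
        (fst h - s) (fst h + s) (snd h - s) (snd h + s) - F h *
        rint (fun z => / (z - h))%C (fst h - s) (fst h + s) (snd h - s) (snd h + s))%C.
      { rewrite Cmult_comm. f_equal. apply rint_ext; try lra.
        intros z Hz. field. apply Cmod_gt_0. apply Hneq in Hz; lra. }
      assert (Hz : forall z, on_boundary (fst h - s) (fst h + s) (snd h - s)
        (snd h + s) z -> z <> h).
      { intros z Hz ->. apply Hneq in Hz; [|lra].
        replace (h - h)%C with (RtoC 0) in Hz by ring. rewrite Cmod_0 in Hz. lra. }
      rewrite rint_plus; try lra.
      - rewrite (rint_mult _ _ _ _) by
          (lra || (intros z Hz'; apply cdiff_ccont, cdiff_inv, Hz, Hz')). ring.
      - intros z Hz'. apply cdiff_ccont, cdiff_div; [now apply Hz|].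
        apply cdiff_minus; [apply HF | apply cdiff_const].
      - intros z Hz'. apply cdiff_ccont.
        apply (cdiff_mult (fun _ => F h)); [apply cdiff_const|].
        now apply cdiff_inv, Hz. }
    rewrite E.
    replace (8 * eps) with (2 * ((fst h + s - (fst h - s)) + (snd h + s - (snd h - s)))
       * (eps / s)) by (field; lra).
    apply rint_bound; try lra.
    - intros z Hz. apply cdiff_ccont, cdiff_div.
      + intros ->. apply Hneq in Hz; [|lra].
        replace (h - h)%C with (RtoC 0) in Hz by ring. rewrite Cmod_0 in Hz. lra.
      + apply cdiff_minus; [apply HF | apply cdiff_const].
    - intros z Hz. assert (Hzh := Hneq z s Hs0 Hz).
      rewrite Cmod_div by (apply Cmod_gt_0; lra).
      assert (Hsmall : Cmod (z - h) < d).
      { destruct z as [x y]; destruct h as [p q]. destruct Hz as (H1 & H2 & _).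
        simpl in H1, H2.
        eapply Rle_lt_trans; [apply (Cmod_Rabs_le (x - p) (y - q))|].
        assert (Rabs (x - p) <= s) by (apply Rabs_le; lra).
        assert (Rabs (y - q) <= s) by (apply Rabs_le; lra). lra. }
      specialize (Hd z Hsmall).
      unfold Rdiv. apply Rmult_le_compat; [apply Cmod_ge_0| | lra |].
      + apply Rlt_le, Rinv_0_lt_compat. lra.
      + apply Rinv_le_contravar; lra. }
  assert (HD0 : D = RtoC 0).
  { apply Cmod_eq_0. apply Rle_antisym; [|apply Cmod_ge_0].
    apply Rnot_lt_le. intros Hpos. specialize (HD (Cmod D / 16)). lra. }
  replace (sq_int (fun z => F z / (z - h))%C r) with (D + kappa * F h)%C
    by (unfold D; ring).
  rewrite HD0. ring.
Qed.

(** Cauchy's integral for the Taylor coefficients at the origin.  The kernel is a power of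
    [/ (z - 0)] so that the lemmas on [/ (z - h)] apply to it. *)
Definition tcoef (F : C -> C) (r : R) (n : nat) : C :=
  (/ kappa * sq_int (fun z => F z * (/ (z - 0)) ^ (S n)) r)%C.

Fixpoint tpoly (a : nat -> C) (h : C) (n : nat) : C :=
  match n with
  | O => RtoC 0
  | S k => (tpoly a h k + a k * h ^ k)%C
  end.

Lemma cdiff_inv_pow (n : nat) (z : C) : z <> RtoC 0 ->
  cdiff (fun y => ((/ (y - 0)) ^ n)%C) z.
Proof. intros Hz. apply cdiff_pow. now apply cdiff_inv. Qed.

Section SquareKernel.

Variables (F : C -> C) (r M : R).
Hypotheses (HF : forall z, ccont F z) (Hr : 0 < r)
  (HM : forall z, Cmod z <= 2 * r -> Cmod (F z) <= M).

Lemma sq_boundary_neq (h z : C) : Cmod h <= r / 2 -> on_boundary (- r) r (- r) r z ->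
  z <> h.
Proof.
  intros Hh Hz ->. apply sq_boundary_Cmod in Hz. lra.
Qed.

Lemma sq_boundary_neq_0 (z : C) : on_boundary (- r) r (- r) r z -> z <> RtoC 0.
Proof. apply sq_boundary_neq. rewrite Cmod_0. lra. Qed.

Lemma Cmod_inv_pow_le (z : C) (n : nat) : on_boundary (- r) r (- r) r z ->
  Cmod ((/ (z - 0)) ^ n) <= (/ r) ^ n.
Proof.
  intros Hz. rewrite Cmod_pow.
  rewrite Cmod_inv by (apply Cminus_neq_0; now apply sq_boundary_neq_0).
  apply sq_boundary_Cmod in Hz. replace (z - 0)%C with z by ring.
  apply pow_incr. split.
  - apply Rlt_le, Rinv_0_lt_compat. lra.
  - apply Rinv_le_contravar; lra.
Qed.

(** The finite geometric expansion of [1 / (z - h)] in powers of [h / z], under the integral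
    sign.  Continuity of [F] is enough here, which lets [weierstrass] use it for a function
    that is not yet known to be differentiable. *)
Lemma taylor_kernel (h : C) (n : nat) : Cmod h <= r / 2 ->
  sq_int (fun z => F z / (z - h))%C r =
  (kappa * tpoly (tcoef F r) h n +
   h ^ n * sq_int (fun z => F z * (/ (z - 0)) ^ n * / (z - h)) r)%C.
Proof.
  intros Hh.
  assert (Hc : forall k z, on_boundary (- r) r (- r) r z ->
    ccont (fun y => F y * (/ (y - 0)) ^ k)%C z).
  { intros k z Hz. apply ccont_mult; [apply HF|].
    apply cdiff_ccont, cdiff_inv_pow. now apply sq_boundary_neq_0. }
  assert (Hc' : forall k z, on_boundary (- r) r (- r) r z ->
    ccont (fun y => F y * (/ (y - 0)) ^ k * / (y - h))%C z).
  { intros k z Hz. apply (ccont_mult (fun y => F y * (/ (y - 0)) ^ k)%C); [now apply Hc|].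
    apply cdiff_ccont, cdiff_inv. now apply sq_boundary_neq. }
  induction n as [|n IH].
  - cbn [tpoly Cpow]. rewrite Cmult_0_r, Cplus_0_l, Cmult_1_l.
    unfold sq_int. apply rint_ext; try lra. intros z _. unfold Cdiv. ring.
  - rewrite IH. simpl tpoly.
    assert (E : sq_int (fun z => F z * (/ (z - 0)) ^ n * / (z - h))%C r =
      (sq_int (fun z => F z * (/ (z - 0)) ^ (S n)) r +
       h * sq_int (fun z => F z * (/ (z - 0)) ^ (S n) * / (z - h)) r)%C).
    { unfold sq_int.
      rewrite <- (rint_mult _ _ _ _) by (lra || apply Hc').
      rewrite <- rint_plus; try lra; [|apply Hc|].
      - apply rint_ext; try lra. intros z Hz. cbn [Cpow].
        set (p := ((/ (z - 0)) ^ n)%C). field. split.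
        + apply Cminus_neq_0. now apply sq_boundary_neq.
        + replace (z - 0)%C with z by ring. now apply sq_boundary_neq_0.
      - intros z Hz. apply (ccont_mult (fun _ => h));
          [apply cdiff_ccont, cdiff_const | now apply Hc']. }
    assert (T : sq_int (fun z => F z * (/ (z - 0)) ^ (S n))%C r =
      (kappa * tcoef F r n)%C).
    { unfold tcoef. rewrite Cmult_assoc, Cinv_r, Cmult_1_l by apply kappa_neq_0.
      reflexivity. }
    rewrite E, T. change (h ^ S n)%C with (h * h ^ n)%C. ring.
Qed.

(** On the contour [1 / |z - h| <= 2 / r], since [h] stays in the inner half. *)
Lemma taylor_remainder (h : C) (n : nat) : Cmod h <= r / 2 ->
  sq_int (fun z => F z / (z - h))%C r = (kappa * F h)%C ->
  Cmod (F h - tpoly (tcoef F r) h n) <= 16 * M * (Cmod h / r) ^ n.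
Proof.
  intros Hh HC. rewrite (taylor_kernel h n Hh) in HC.
  set (I := sq_int (fun z => F z * (/ (z - 0)) ^ n * / (z - h))%C r) in *.
  assert (E : (F h - tpoly (tcoef F r) h n = / kappa * (h ^ n * I))%C).
  { replace (F h) with (/ kappa * (kappa * F h))%C by (field; apply kappa_neq_0).
    rewrite <- HC. field. apply kappa_neq_0. }
  rewrite E. eapply Rle_trans; [apply Cmod_inv_kappa_le|].
  rewrite Cmod_mult, Cmod_pow.
  assert (HI : Cmod I <= 2 * ((r - - r) + (r - - r)) * (M * (/ r) ^ n * (2 / r))).
  { unfold I, sq_int. apply rint_bound; try lra.
    - intros z Hz. apply (ccont_mult (fun y => F y * (/ (y - 0)) ^ n)%C).
      + apply ccont_mult; [apply HF|].
        apply cdiff_ccont, cdiff_inv_pow. now apply sq_boundary_neq_0.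
      + apply cdiff_ccont, cdiff_inv. now apply sq_boundary_neq.
    - intros z Hz. rewrite !Cmod_mult.
      assert (Hz' := sq_boundary_Cmod r z Hz).
      apply Rmult_le_compat; try apply Cmod_ge_0.
      + rewrite <- Cmod_mult. apply Cmod_ge_0.
      + apply Rmult_le_compat; try apply Cmod_ge_0.
        * apply HM; lra.
        * now apply Cmod_inv_pow_le.
      + rewrite Cmod_inv by (apply Cminus_neq_0; now apply sq_boundary_neq).
        assert (Hzh : r / 2 <= Cmod (z - h)).
        { assert (H := Cmod_triangle (z - h) h).
          replace (z - h + h)%C with z in H by ring. lra. }
        replace (2 / r) with (/ (r / 2)) by (field; lra).
        apply Rinv_le_contravar; lra. }
  apply Rle_trans with (Cmod h ^ n *
    (2 * ((r - - r) + (r - - r)) * (M * (/ r) ^ n * (2 / r)))).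
  - apply Rmult_le_compat_l; [apply pow_le, Cmod_ge_0 | assumption].
  - unfold Rdiv. rewrite Rpow_mult_distr. right. field. lra.
Qed.

Lemma tcoef_bound (n : nat) : Cmod (tcoef F r n) <= 8 * M * (/ r) ^ n.
Proof.
  eapply Rle_trans; [apply Cmod_inv_kappa_le|].
  replace (8 * M * (/ r) ^ n) with
    (2 * ((r - - r) + (r - - r)) * (M * (/ r) ^ (S n))) by (simpl; field; lra).
  unfold sq_int. apply rint_bound; try lra.
  - intros z Hz. apply ccont_mult; [apply HF|].
    apply cdiff_ccont, cdiff_inv_pow. now apply sq_boundary_neq_0.
  - intros z Hz. rewrite Cmod_mult.
    apply Rmult_le_compat; try apply Cmod_ge_0.
    + apply HM. apply sq_boundary_Cmod in Hz. lra.
    + now apply Cmod_inv_pow_le.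
Qed.

End SquareKernel.

(** The integrand has its only singularity at the origin. *)
Lemma tcoef_radius (F : C -> C) (r r' : R) (n : nat) :
  (forall z, cdiff F z) -> 0 < r' <= r -> tcoef F r n = tcoef F r' n.
Proof.
  intros HF Hr. unfold tcoef, sq_int. f_equal. apply rint_annulus; try lra.
  intros z _ _ Hz. apply (cdiff_mult F); [apply HF|]. apply cdiff_inv_pow.
  intros ->. apply Hz. simpl. lra.
Qed.

(** A geometric sum of ratio [q >= 2] is at most the next power of [q]. *)
Lemma tpoly_bound (a : nat -> C) (h : C) (q K : R) (n : nat) : 2 <= q -> 0 <= K ->
  (forall k, Cmod (a k * h ^ k) <= K * q ^ k) ->
  Cmod (tpoly a h n) <= K * q ^ n.
Proof.
  intros Hq HK Ha. induction n as [|n IH].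
  - simpl. rewrite Cmod_0. lra.
  - simpl. eapply Rle_trans; [apply Cmod_triangle|].
    specialize (Ha n). assert (0 <= q ^ n) by (apply pow_le; lra).
    assert (0 <= K * q ^ n) by now apply Rmult_le_pos. nra.
Qed.

(** A weak form of Hadamard's three circles theorem.  The coefficients are estimated
    on the small circle and the remainder on the large one; [n] is left free and will
    be adapted to the size of [M]. *)
Lemma three_circles (F : C -> C) (r1 r M1 M q : R) (h : C) (n : nat) :
  (forall z, cdiff F z) -> 0 < r1 <= r -> 0 <= M1 -> 2 <= q ->
  (forall z, Cmod z <= 2 * r1 -> Cmod (F z) <= M1) ->
  (forall z, Cmod z <= 2 * r -> Cmod (F z) <= M) ->
  Cmod h <= r / 2 -> Cmod h <= q * r1 ->
  Cmod (F h) <= 8 * M1 * q ^ n + 16 * M * (1 / 2) ^ n.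
Proof.
  intros HF Hr HM1 Hq H1 H2 Hh Hhq.
  assert (Hcont : forall z, ccont F z) by (intros; apply cdiff_ccont, HF).
  assert (R1 := taylor_remainder F r M Hcont ltac:(lra) H2 h n Hh
    (cauchy_formula F r h HF ltac:(lra) Hh)).
  assert (R2 : Cmod (tpoly (tcoef F r) h n) <= 8 * M1 * q ^ n).
  { apply tpoly_bound; [assumption | lra|]. intros k.
    rewrite (tcoef_radius F r r1 k HF Hr), Cmod_mult, Cmod_pow.
    assert (B := tcoef_bound F r1 M1 Hcont ltac:(lra) H1 k).
    apply Rle_trans with (8 * M1 * (/ r1) ^ k * (q * r1) ^ k).
    - apply Rmult_le_compat; [apply Cmod_ge_0 | apply pow_le, Cmod_ge_0 | assumption|].
      apply pow_incr. split; [apply Cmod_ge_0 | assumption].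
    - right. rewrite Rpow_mult_distr.
      transitivity (8 * M1 * q ^ k * ((/ r1) ^ k * r1 ^ k)); [ring|].
      rewrite <- Rpow_mult_distr, Rinv_l, pow1 by lra. ring. }
  assert (HM : 0 <= M).
  { eapply Rle_trans; [apply (Cmod_ge_0 (F 0%C))|]. apply H2. rewrite Cmod_0. lra. }
  assert (R3 : (Cmod h / r) ^ n <= (1 / 2) ^ n).
  { apply pow_incr. split.
    - apply Rmult_le_pos; [apply Cmod_ge_0 | apply Rlt_le, Rinv_0_lt_compat; lra].
    - apply (Rmult_le_reg_r r); [lra|]. unfold Rdiv.
      rewrite Rmult_assoc, Rinv_l by lra. lra. }
  replace (F h) with ((F h - tpoly (tcoef F r) h n) + tpoly (tcoef F r) h n)%C by ring.
  eapply Rle_trans; [apply Cmod_triangle|].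
  assert (16 * M * (Cmod h / r) ^ n <= 16 * M * (1 / 2) ^ n)
    by (apply Rmult_le_compat_l; lra).
  lra.
Qed.

(** On the contour of radius [r] the remainder after the constant term is of order
    [|h| / r], where [r] is arbitrary. *)
Theorem liouville (F : C -> C) (M : R) : (forall z, cdiff F z) ->
  (forall z, Cmod (F z) <= M) -> forall z, F z = F 0%C.
Proof.
  intros HF HM h.
  assert (Hcont : forall z, ccont F z) by (intros; apply cdiff_ccont, HF).
  assert (HM0 : 0 <= M) by (eapply Rle_trans; [apply (Cmod_ge_0 (F 0%C)) | apply HM]).
  assert (K : forall h, F h = tcoef F 1 0).
  { clear h. intros h.
    apply NNPP. intros Hne. apply Cminus_neq_0, Cmod_gt_0 in Hne.
    set (d := Cmod (F h - tcoef F 1 0)) in *.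
    assert (Hh := Cmod_ge_0 h).
    (* Large enough for the remainder [16 * M * |h| / r] to be smaller than [d]. *)
    set (r := 1 + 2 * Cmod h + 16 * M * Cmod h / d).
    assert (Hr : 1 + 2 * Cmod h <= r).
    { unfold r. assert (0 <= 16 * M * Cmod h / d); [|lra].
      apply Rmult_le_pos; [|apply Rlt_le, Rinv_0_lt_compat; lra].
      apply Rmult_le_pos; lra. }
    assert (R1 := taylor_remainder F r M Hcont ltac:(lra) (fun z _ => HM z) h 1
      ltac:(lra) (cauchy_formula F r h HF ltac:(lra) ltac:(lra))).
    simpl in R1. rewrite (tcoef_radius F r 1) in R1 by (assumption || lra).
    replace (F h - (0 + tcoef F 1 0 * 1))%C with (F h - tcoef F 1 0)%C in R1 by ring.
    fold d in R1. rewrite Rmult_1_r in R1.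
    apply (Rmult_le_compat_r r) in R1; [|lra].
    replace (16 * M * (Cmod h / r) * r) with (16 * M * Cmod h) in R1 by (field; lra).
    assert (E : d * r = d * (1 + 2 * Cmod h) + 16 * M * Cmod h)
      by (unfold r; field; lra).
    nra. }
  now rewrite (K h), (K 0%C).
Qed.

(** * Bounds on disks, compactness of disks, limits of entire functions *)

Lemma Cmod_le_square (z c : C) (r : R) : Cmod (z - c) <= r ->
  fst c - r <= fst z <= fst c + r /\ snd c - r <= snd z <= snd c + r.
Proof.
  intros H.
  assert (H1 := Rle_trans _ _ _ (Rabs_fst_le_Cmod _) H).
  assert (H2 := Rle_trans _ _ _ (Rabs_snd_le_Cmod _) H).
  apply Rabs_le_between in H1, H2. simpl in H1, H2. lra.
Qed.

Lemma Cmod_rectangle (x y p q delta a b c d : R) :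
  a <= x -> x <= b -> c <= y -> y <= d -> b - a < delta -> d - c < delta ->
  a <= p <= b -> c <= q <= d -> Cmod ((p, q) - (x, y)) < 2 * delta.
Proof.
  intros. eapply Rle_lt_trans; [apply (Cmod_Rabs_le (p - x) (q - y))|].
  assert (Rabs (p - x) < delta) by (apply Rabs_def1; lra).
  assert (Rabs (q - y) < delta) by (apply Rabs_def1; lra). lra.
Qed.

Lemma ccont_bounded_disk (F : C -> C) (r : R) : (forall z, ccont F z) ->
  exists M, forall z, Cmod z <= r -> Cmod (F z) <= M.
Proof.
  intros HF. destruct (Rle_dec 0 r) as [Hr|Hr].
  2:{ exists 0. intros z Hz. assert (H := Cmod_ge_0 z). lra. }
  assert (H : exists M, forall p q, - r <= p <= r -> - r <= q <= r ->
    Cmod (F (p, q)) <= M).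
  { apply (rectangle_bisection (fun a b c d => exists M, forall p q,
      a <= p <= b -> c <= q <= d -> Cmod (F (p, q)) <= M)); try lra.
    - intros a b c d _ Hab _ _ Hcd _ [M1 H1] [M2 H2] [M3 H3] [M4 H4].
      exists (Rmax (Rmax M1 M2) (Rmax M3 M4)). intros p q Hp Hq.
      destruct (Rle_dec p ((a + b) / 2)); destruct (Rle_dec q ((c + d) / 2)).
      + eapply Rle_trans; [apply H1; lra|].
        eapply Rle_trans; [apply Rmax_l | apply Rmax_l].
      + eapply Rle_trans; [apply H3; lra|].
        eapply Rle_trans; [apply Rmax_l | apply Rmax_r].
      + eapply Rle_trans; [apply H2; lra|].
        eapply Rle_trans; [apply Rmax_r | apply Rmax_l].
      + eapply Rle_trans; [apply H4; lra|].
        eapply Rle_trans; [apply Rmax_r | apply Rmax_r].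
    - intros x y _ _. destruct (HF (x, y) 1 Rlt_0_1) as [d [Hd0 Hd]].
      exists (d / 2). split; [lra|].
      intros a b c e H1 H2 H3 H4 H5 H6. exists (Cmod (F (x, y)) + 1).
      intros p q Hp Hq.
      assert (H7 : Cmod ((p, q) - (x, y)) < 2 * (d / 2))
        by (apply Cmod_rectangle with a b c e; lra).
      assert (H8 := Hd (p, q) ltac:(lra)).
      assert (H9 := Cmod_triangle (F (p, q) - F (x, y)) (F (x, y))).
      replace (F (p, q) - F (x, y) + F (x, y))%C with (F (p, q)) in H9 by ring. lra. }
  destruct H as [M H]. exists M. intros [p q] Hz.
  replace ((p, q) : C) with ((p, q) - 0)%C in Hz
    by (apply injective_projections; simpl; ring).
  apply Cmod_le_square in Hz. simpl in Hz. apply H; lra.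
Qed.

Lemma open_Cmod (U : C -> Prop) (z : C) : open U -> U z ->
  exists delta, 0 < delta /\ forall y : C, Cmod (y - z) < delta -> U y.
Proof.
  intros HU Hz. destruct (HU z Hz) as [d Hd].
  exists d. split; [apply cond_pos|]. intros y Hy. apply Hd. split.
  - exact (Rle_lt_trans _ _ _ (Rabs_fst_le_Cmod (y - z)) Hy).
  - exact (Rle_lt_trans _ _ _ (Rabs_snd_le_Cmod (y - z)) Hy).
Qed.

(** Bisection of a square that contains the disk; small rectangles that do not meet the
    disk need no member of the cover. *)
Lemma compact_closed_disk (c0 : C) (r : R) : compact_set (closed_disk c0 r).
Proof.
  destruct (Rle_dec 0 r) as [Hr|Hr].
  2:{ intros I U _ _. exists nil. intros z Hz. unfold closed_disk in Hz.
      assert (H := Cmod_ge_0 (z - c0)). lra. }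
  intros I U HU HK.
  assert (H : exists l : list I, forall p q, fst c0 - r <= p <= fst c0 + r ->
    snd c0 - r <= q <= snd c0 + r -> closed_disk c0 r (p, q) ->
    exists i, List.In i l /\ U i (p, q)).
  { apply (rectangle_bisection (fun a b c d => exists l : list I, forall p q,
      a <= p <= b -> c <= q <= d -> closed_disk c0 r (p, q) ->
      exists i, List.In i l /\ U i (p, q))); try lra.
    - intros a b c d _ Hab _ _ Hcd _ [l1 H1] [l2 H2] [l3 H3] [l4 H4].
      exists (l1 ++ l2 ++ l3 ++ l4)%list. intros p q Hp Hq Hpq.
      assert (Hcase : exists i, (List.In i l1 \/ List.In i l2 \/ List.In i l3 \/
        List.In i l4) /\ U i (p, q)).
      { destruct (Rle_dec p ((a + b) / 2)); destruct (Rle_dec q ((c + d) / 2)).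
        - destruct (H1 p q) as [i [Hi Hu]]; try lra; try assumption. exists i; tauto.
        - destruct (H3 p q) as [i [Hi Hu]]; try lra; try assumption. exists i; tauto.
        - destruct (H2 p q) as [i [Hi Hu]]; try lra; try assumption. exists i; tauto.
        - destruct (H4 p q) as [i [Hi Hu]]; try lra; try assumption. exists i; tauto. }
      destruct Hcase as [i [Hi Hu]]. exists i. split; [|assumption].
      rewrite !List.in_app_iff. tauto.
    - intros x y _ _. destruct (Rle_dec (Cmod ((x, y) - c0)) r) as [Hin|Hout].
      + destruct (HK (x, y) Hin) as [i Hi].
        destruct (open_Cmod (U i) (x, y) (HU i) Hi) as [d [Hd0 Hd]].
        exists (d / 2). split; [lra|].
        intros a b c e H1 H2 H3 H4 H5 H6. exists (cons i nil).
        intros p q Hp Hq _. exists i. split; [now left|]. apply Hd.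
        assert (H7 : Cmod ((p, q) - (x, y)) < 2 * (d / 2))
          by (apply Cmod_rectangle with a b c e; lra). lra.
      + set (d := Cmod ((x, y) - c0) - r). assert (Hd0 : 0 < d) by (unfold d; lra).
        exists (d / 2). split; [lra|].
        intros a b c e H1 H2 H3 H4 H5 H6. exists nil.
        intros p q Hp Hq Hpq. exfalso. unfold closed_disk in Hpq.
        assert (H7 : Cmod ((p, q) - (x, y)) < 2 * (d / 2))
          by (apply Cmod_rectangle with a b c e; lra).
        assert (H8 := Cmod_triangle_rev ((x, y) - c0) ((p, q) - (x, y))).
        replace ((x, y) - c0 + ((p, q) - (x, y)))%C with ((p, q) - c0)%C in H8 by ring.
        unfold d in H7. lra. }
  destruct H as [l H]. exists l. intros [p q] Hz.
  assert (Hz' := Cmod_le_square (p, q) c0 r Hz). apply H; simpl in Hz'; tauto.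
Qed.

(** The disks of integer radius around the origin form an open cover. *)
Lemma compact_bounded (K : C -> Prop) : compact_set K ->
  exists r, forall z, K z -> Cmod z <= r.
Proof.
  intros HK. destruct (HK nat (fun n z => Cmod z < INR n)) as [l Hl].
  - intros n z Hz.
    assert (Hd : 0 < (INR n - Cmod z) / 2) by lra.
    exists (mkposreal _ Hd). intros y [H1 H2].
    change (Rabs (fst y - fst z) < (INR n - Cmod z) / 2) in H1.
    change (Rabs (snd y - snd z) < (INR n - Cmod z) / 2) in H2.
    assert (H3 := Cmod_Rabs_le (fst y - fst z) (snd y - snd z)).
    assert (H4 := Cmod_triangle z (fst y - fst z, snd y - snd z)).
    replace (z + ((fst y - fst z)%R, (snd y - snd z)%R))%C with y in H4
      by (apply injective_projections; simpl; ring).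
    lra.
  - intros z _. destruct (INR_unbounded (Cmod z)) as [n Hn]. now exists n.
  - exists (INR (List.fold_right Nat.max O l)). intros z Hz.
    destruct (Hl z Hz) as [n [Hn Hzn]].
    assert (Hmax : (n <= List.fold_right Nat.max O l)%nat).
    { clear -Hn. induction l as [|m l IH]; simpl in *; [tauto|].
      destruct Hn as [->|Hn]; [lia|]. specialize (IH Hn). lia. }
    apply le_INR in Hmax. lra.
Qed.

(** Cauchy's formula passes to the uniform limit, and it gives back differentiability:
    the Taylor polynomial of degree one has a quadratic remainder. *)
Theorem weierstrass (F : C -> C) :
  (forall r eps, 0 < eps -> exists G, (forall z, cdiff G z) /\
     forall z, Cmod z <= r -> Cmod (G z - F z) <= eps) ->
  forall z, cdiff F z.
Proof.
  intros Happ.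
  assert (Hcont : forall z, ccont F z).
  { intros z eps He. destruct (Happ (Cmod z + 1) (eps / 4)) as [G [HG HGF]]; [lra|].
    destruct (cdiff_ccont G z (HG z) (eps / 4)) as [d [Hd0 Hd]]; [lra|].
    exists (Rmin d 1). split; [apply Rmin_pos; lra|]. intros y Hy.
    specialize (Hd y (Rlt_le_trans _ _ _ Hy (Rmin_l _ _))).
    assert (Hy1 := Rlt_le_trans _ _ _ Hy (Rmin_r _ _)).
    assert (Hyz := Cmod_triangle (y - z) z).
    replace (y - z + z)%C with y in Hyz by ring.
    assert (E1 := HGF y ltac:(lra)). assert (E2 := HGF z ltac:(lra)).
    replace (F y - F z)%C with ((G y - G z) + (G z - F z) - (G y - F y))%C by ring.
    eapply Rle_lt_trans; [apply Cmod_triangle_minus|].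
    eapply Rle_lt_trans; [apply Rplus_le_compat_r, Cmod_triangle|]. lra. }
  intros z0.
  set (f := fun z => F (1 * z + z0)%C).
  assert (Hf : forall z, ccont f z).
  { intros z eps He. destruct (Hcont (1 * z + z0)%C eps He) as [d [Hd0 Hd]].
    exists d. split; [assumption|]. intros y Hy. apply Hd.
    replace (1 * y + z0 - (1 * z + z0))%C with (y - z)%C by ring. assumption. }
  assert (Hform : forall h, Cmod h <= 1 / 2 ->
    sq_int (fun z => f z / (z - h))%C 1 = (kappa * f h)%C).
  { intros h Hh.
    set (D := (sq_int (fun z => f z / (z - h)) 1 - kappa * f h)%C).
    assert (HD : forall eps, 0 < eps -> Cmod D <= (16 + Cmod kappa) * eps).
    { intros eps He. destruct (Happ (2 + Cmod z0) eps He) as [G [HG HGF]].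
      set (g := fun z => G (1 * z + z0)%C).
      assert (Hg : forall z, cdiff g z) by (intros z; apply cdiff_affine, HG).
      assert (Hgf : forall z, Cmod z <= 2 -> Cmod (g z - f z) <= eps).
      { intros z Hz. apply HGF. assert (H := Cmod_triangle (1 * z) z0).
        replace (1 * z)%C with z in * by ring. lra. }
      assert (Hb : forall z, on_boundary (- (1)) 1 (- (1)) 1 z -> z <> h)
        by (intros z Hz; apply (sq_boundary_neq 1 ltac:(lra) h z ltac:(lra) Hz)).
      assert (Hq : forall z, on_boundary (- (1)) 1 (- (1)) 1 z ->
        ccont (fun z => - (1) * ((g z + - (1) * f z) / (z - h)))%C z).
      { intros z Hz. apply (ccont_mult (fun _ => - (1))%C);
          [apply cdiff_ccont, cdiff_const|].
        apply (ccont_mult (fun z => g z + - (1) * f z)%C).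
        - apply ccont_plus; [apply cdiff_ccont, Hg|].
          apply (ccont_mult (fun _ => - (1))%C); [apply cdiff_ccont, cdiff_const|].
          apply Hf.
        - apply cdiff_ccont, cdiff_inv. now apply Hb. }
      assert (E : D = (kappa * (g h - f h) +
        sq_int (fun z => - (1) * ((g z + - (1) * f z) / (z - h)))%C 1)%C).
      { unfold D.
        rewrite (Cmult_comm kappa (g h - f h)).
        replace ((g h - f h) * kappa)%C with (kappa * g h - kappa * f h)%C by ring.
        rewrite <- (cauchy_formula g 1 h Hg) by lra.
        assert (E : sq_int (fun z => f z / (z - h))%C 1 =
          (sq_int (fun z => g z / (z - h)) 1 +
           sq_int (fun z => - (1) * ((g z + - (1) * f z) / (z - h))) 1)%C).
        { unfold sq_int. rewrite <- rint_plus; try lra; [|intros z Hz|exact Hq].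
          - apply rint_ext; try lra. intros z Hz. field.
            now apply Cminus_neq_0, Hb.
          - apply cdiff_ccont, cdiff_div; [now apply Hb | apply Hg]. }
        rewrite E. ring. }
      rewrite E. eapply Rle_trans; [apply Cmod_triangle|]. rewrite Cmod_mult.
      assert (B1 : Cmod kappa * Cmod (g h - f h) <= Cmod kappa * eps)
        by (apply Rmult_le_compat_l; [apply Cmod_ge_0 | apply Hgf; lra]).
      assert (B2 : Cmod (sq_int (fun z => - (1) * ((g z + - (1) * f z) / (z - h)))%C 1)
        <= 2 * ((1 - - (1)) + (1 - - (1))) * (2 * eps)).
      { unfold sq_int. apply rint_bound; try lra.
        - exact Hq.
        - intros z Hz. assert (Hzh : z <> h)
            by (apply (sq_boundary_neq 1 ltac:(lra) h z ltac:(lra) Hz)).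
          apply sq_boundary_Cmod in Hz.
          assert (Hzh2 : 1 / 2 <= Cmod (z - h)).
          { assert (H := Cmod_triangle (z - h) h).
            replace (z - h + h)%C with z in H by ring. lra. }
          replace (g z + - (1) * f z)%C with (g z - f z)%C by ring.
          replace (- (1) * ((g z - f z) / (z - h)))%C with
            (- ((g z - f z) / (z - h)))%C by ring.
          rewrite Cmod_opp, Cmod_div by now apply Cminus_neq_0.
          unfold Rdiv. rewrite (Rmult_comm 2). apply Rmult_le_compat.
          + apply Cmod_ge_0.
          + apply Rlt_le, Rinv_0_lt_compat. lra.
          + apply Hgf. lra.
          + replace 2 with (/ (1 / 2)) by field. apply Rinv_le_contravar; lra. }
      lra. }
    assert (HD0 : D = RtoC 0).
    { apply Cmod_eq_0. apply Rle_antisym; [|apply Cmod_ge_0].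
      apply Rnot_lt_le. intros Hpos.
      assert (K := Cmod_kappa_ge_1).
      assert (K2 : 0 < Cmod D / (2 * (16 + Cmod kappa)))
        by (apply Rdiv_lt_0_compat; lra).
      specialize (HD _ K2).
      replace ((16 + Cmod kappa) * (Cmod D / (2 * (16 + Cmod kappa)))) with
        (Cmod D / 2) in HD by (field; lra).
      lra. }
    replace (sq_int (fun z => f z / (z - h))%C 1) with (D + kappa * f h)%C
      by (unfold D; ring).
    rewrite HD0. ring. }
  destruct (ccont_bounded_disk f 2 Hf) as [M HM].
  assert (Htaylor : forall h, Cmod h <= 1 / 2 ->
    Cmod (f h - (tcoef f 1 0 + tcoef f 1 1 * h)) <= 16 * M * (Cmod h * Cmod h)).
  { intros h Hh.
    assert (R1 := taylor_remainder f 1 M Hf ltac:(lra)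
      ltac:(intros z Hz; apply HM; lra) h 2 Hh (Hform h Hh)).
    simpl in R1. replace (Cmod h / 1) with (Cmod h) in R1 by field.
    replace (f h - (tcoef f 1 0 + tcoef f 1 1 * h))%C with
      (f h - (0 + tcoef f 1 0 * 1 + tcoef f 1 1 * (h * 1)))%C by ring.
    rewrite !Rmult_1_r in R1. exact R1. }
  assert (Hf0 : f 0%C = tcoef f 1 0).
  { assert (R1 := Htaylor 0%C). rewrite Cmod_0 in R1. specialize (R1 ltac:(lra)).
    replace (f 0%C - (tcoef f 1 0 + tcoef f 1 1 * 0))%C with
      (f 0%C - tcoef f 1 0)%C in R1 by ring.
    apply NNPP. intros Hne. apply Cminus_neq_0, Cmod_gt_0 in Hne. lra. }
  exists (tcoef f 1 1). intros eps He.
  assert (HM0 : 0 <= M).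
  { eapply Rle_trans; [apply (Cmod_ge_0 (f 0%C))|]. apply HM. rewrite Cmod_0. lra. }
  exists (Rmin (1 / 2) (eps / (16 * M + 1))).
  split; [apply Rmin_pos; [lra | apply Rdiv_lt_0_compat; lra]|].
  intros y Hy.
  assert (Hy1 := Rlt_le_trans _ _ _ Hy (Rmin_l _ _)).
  assert (Hy2 := Rlt_le_trans _ _ _ Hy (Rmin_r _ _)).
  specialize (Htaylor (y - z0)%C ltac:(lra)).
  rewrite <- Hf0 in Htaylor. unfold f at 1 2 in Htaylor.
  replace (1 * (y - z0) + z0)%C with y in Htaylor by ring.
  replace (1 * 0 + z0)%C with z0 in Htaylor by ring.
  replace (F y - F z0 - tcoef f 1 1 * (y - z0))%C with
    (F y - (F z0 + tcoef f 1 1 * (y - z0)))%C by ring.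
  eapply Rle_trans; [exact Htaylor|].
  apply (Rmult_lt_compat_r (16 * M + 1)) in Hy2; [|lra].
  replace (eps / (16 * M + 1) * (16 * M + 1)) with eps in Hy2 by (field; lra).
  assert (P := Cmod_ge_0 (y - z0)). nra.
Qed.

(** * The maximum modulus *)

(** The hypothesis [0 <= B] covers an empty [K], where [max_on] is 0. *)
Lemma max_on_le (K : C -> Prop) (F : C -> C) (B : R) : 0 <= B ->
  (forall z, K z -> Cmod (F z) <= B) -> max_on K F <= B.
Proof.
  intros HB H. unfold max_on.
  destruct (Lub_Rbar_correct (fun y : R => exists z : C, K z /\ y = Cmod (F z)))
    as [_ Hleast].
  specialize (Hleast (Finite B)).
  destruct (Lub_Rbar _) as [l| |]; simpl; [|exfalso|assumption].
  - apply Hleast. intros y [z [Hz ->]]. simpl. now apply H.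
  - apply Hleast. intros y [z [Hz ->]]. simpl. now apply H.
Qed.

(** Some bound [B] is needed: for an infinite supremum [max_on] would be 0. *)
Lemma le_max_on (K : C -> Prop) (F : C -> C) (B : R) (z : C) :
  (forall z, K z -> Cmod (F z) <= B) -> K z -> Cmod (F z) <= max_on K F.
Proof.
  intros H Hz. unfold max_on.
  destruct (Lub_Rbar_correct (fun y : R => exists z : C, K z /\ y = Cmod (F z)))
    as [Hub Hleast].
  assert (H1 : Rbar_le (Cmod (F z)) (Lub_Rbar (fun y : R =>
    exists z : C, K z /\ y = Cmod (F z)))) by (apply Hub; now exists z).
  specialize (Hleast (Finite B)).
  destruct (Lub_Rbar _) as [l| |]; simpl in *; [assumption|exfalso|contradiction].
  apply Hleast. intros y [w [Hw ->]]. simpl. now apply H.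
Qed.

Lemma closed_disk_0 (r : R) (z : C) : closed_disk 0%C r z <-> Cmod z <= r.
Proof. unfold closed_disk. now replace (z - 0)%C with z by ring. Qed.

Section MaxModulus.

Variable F : C -> C.
Hypothesis HF : forall z, ccont F z.

Lemma le_max_modulus (r : R) (z : C) : Cmod z <= r -> Cmod (F z) <= max_modulus F r.
Proof.
  intros Hz. destruct (ccont_bounded_disk F r HF) as [B HB].
  apply (le_max_on _ _ B); [|now apply closed_disk_0].
  intros w Hw. now apply HB, closed_disk_0.
Qed.

Lemma max_modulus_ge_0 (r : R) : 0 <= r -> 0 <= max_modulus F r.
Proof.
  intros Hr. eapply Rle_trans; [apply (Cmod_ge_0 (F 0%C))|].
  apply le_max_modulus. now rewrite Cmod_0.
Qed.

Lemma max_modulus_le (r B : R) : 0 <= B ->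
  (forall z, Cmod z <= r -> Cmod (F z) <= B) -> max_modulus F r <= B.
Proof.
  intros HB H. apply max_on_le; [assumption|].
  intros z Hz. now apply H, closed_disk_0.
Qed.

Lemma max_modulus_mono (r r' : R) : 0 <= r <= r' -> max_modulus F r <= max_modulus F r'.
Proof.
  intros Hr. apply max_modulus_le; [apply max_modulus_ge_0; lra|].
  intros z Hz. apply le_max_modulus. lra.
Qed.

End MaxModulus.

Lemma LimInf_infty_ge (f : R -> R) (T l : R) :
  (forall t, T < t -> l <= f t) -> Rbar_le l (LimInf_infty f).
Proof.
  intros H. unfold LimInf_infty.
  unfold Rbar_lub. destruct (Rbar_ex_lub _) as [L HL].
  change (Rbar_le l L).
  destruct HL as [Hub _].
  apply Rbar_le_trans with (Glb_Rbar (fun x : R => exists t : R, T < t /\ x = f t)).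
  - apply Glb_Rbar_correct. intros x [t [Ht ->]]. now apply H.
  - apply Hub. now exists T.
Qed.

Lemma LimSup_infty_le (f : R -> R) (T l : R) :
  (forall t, T < t -> f t <= l) -> Rbar_le (LimSup_infty f) l.
Proof.
  intros H. unfold LimSup_infty.
  unfold Rbar_glb. destruct (Rbar_ex_glb _) as [L HL].
  change (Rbar_le L l).
  destruct HL as [Hlb _].
  apply Rbar_le_trans with (Lub_Rbar (fun x : R => exists t : R, T < t /\ x = f t)).
  - apply Hlb. now exists T.
  - apply Lub_Rbar_correct. intros x [t [Ht ->]]. now apply H.
Qed.

(** * The lower bound *)

(** By recurrence [F] keeps, near every point of the plane, the bound that it satisfies on
    the unit disk. *)
Lemma recurrent_uniform_bound (F : C -> C) : (forall z, cdiff F z) ->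
  locally_uniformly_recurrent F ->
  exists A r0, 0 <= A /\ 1 <= r0 /\ forall z, exists w, Cmod (z - w) <= r0 /\
    forall u, Cmod u <= 1 -> Cmod (F (u + w)%C) <= A.
Proof.
  intros HF Hrec.
  destruct (Hrec 1 (closed_disk 0%C 1) Rlt_0_1 (compact_closed_disk _ _))
    as [r0 [Hr0 Hdense]].
  assert (Hcont : forall z, ccont F z) by (intros; apply cdiff_ccont, HF).
  assert (HA := max_modulus_ge_0 F Hcont 1 Rle_0_1).
  exists (max_modulus F 1 + 1), (Rmax r0 1).
  split; [lra|]. split; [apply Rmax_r|]. intros z.
  destruct (Hdense z (Rmax r0 1) (Rmax_l _ _)) as [w [Hw Hzw]].
  exists w. split; [rewrite Cmod_minus_sym; exact Hzw|].
  intros u Hu.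
  assert (Hdiff : forall y, ccont (fun y => (translate w F y - F y)%C) y).
  { intros y. apply cdiff_ccont, cdiff_minus; [|apply HF].
    apply (cdiff_ext (fun y => F (1 * y + w)%C)).
    - intros t. unfold translate. now rewrite Cmult_1_l.
    - apply cdiff_affine, HF. }
  destruct (ccont_bounded_disk _ 1 Hdiff) as [B HB].
  assert (H := le_max_on (closed_disk 0%C 1) (fun y => (translate w F y - F y)%C) B u
    (fun y Hy => HB y (proj1 (closed_disk_0 1 y) Hy)) (proj2 (closed_disk_0 1 u) Hu)).
  cbv beta in H. unfold translate in H at 1.
  assert (H1 := le_max_modulus F Hcont 1 u Hu).
  assert (H2 := Cmod_triangle (F (u + w)%C - F u)%C (F u)).
  replace (F (u + w)%C - F u + F u)%C with (F (u + w)%C) in H2 by ring.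
  lra.
Qed.

Lemma exists_power_bracket (Q M : R) : 2 <= Q -> 1 <= M ->
  exists n : nat, Q ^ n <= M < Q ^ (S n).
Proof.
  intros HQ HM.
  assert (H : forall N : nat, M < Q ^ N -> exists n : nat, Q ^ n <= M < Q ^ (S n)).
  { induction N as [|N IH]; intros HN; [simpl in HN; lra|].
    destruct (Rle_dec (Q ^ N) M) as [H|H]; [now exists N|]. apply IH. lra. }
  destruct (Pow_x_infinity Q) with (b := M + 1) as [N HN].
  { rewrite Rabs_pos_eq; lra. }
  specialize (HN N (le_n N)). rewrite Rabs_pos_eq in HN by (apply pow_le; lra).
  apply (H N). lra.
Qed.

(** The three circles inequality, applied around a nearby point where [F] is bounded by
    [A], with the number [n] of terms such that the two error terms are of the same
    order. *)
Lemma log_max_modulus_contraction (F : C -> C) : (forall z, cdiff F z) ->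
  locally_uniformly_recurrent F ->
  exists c theta s, 0 < c /\ 0 < theta < 1 /\ 0 < s /\
    forall rho, 0 <= rho -> 1 <= max_modulus F rho ->
      ln (max_modulus F rho) <= c + theta * ln (max_modulus F (rho + s)).
Proof.
  intros HF Hrec.
  assert (Hcont : forall z, ccont F z) by (intros; apply cdiff_ccont, HF).
  destruct (recurrent_uniform_bound F HF Hrec) as (A & r0 & HA & Hr0 & Hw).
  (* [Q ^ n <= M] is to give [q ^ n <= M / 2 ^ n], so that both error terms of
     [three_circles] are of order [M / 2 ^ n]. *)
  set (q := 2 * r0). set (Q := 2 * q).
  assert (Hln2 : 0 < ln 2) by (rewrite <- ln_1; apply ln_increasing; lra).
  assert (HlnQ : ln 2 < ln Q) by (apply ln_increasing; unfold Q, q; lra).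
  exists (ln (8 * A + 16) + ln 2), (1 - ln 2 / ln Q), (5 * r0).
  assert (HlnA : 0 < ln (8 * A + 16)) by (rewrite <- ln_1; apply ln_increasing; lra).
  assert (Hth : 0 < ln 2 / ln Q < 1).
  { split; [apply Rdiv_lt_0_compat; lra|].
    apply (Rmult_lt_reg_r (ln Q)); [lra|]. unfold Rdiv.
    rewrite Rmult_assoc, Rinv_l by lra. lra. }
  split; [lra|]. split; [lra|]. split; [lra|].
  intros rho Hrho Hmu.
  set (M := max_modulus F (rho + 5 * r0)).
  assert (HM : max_modulus F rho <= M)
    by (apply (max_modulus_mono F Hcont); lra).
  destruct (exists_power_bracket Q M) as [n [Hn1 Hn2]]; [unfold Q, q; lra | lra |].
  assert (Hp : 0 < (1 / 2) ^ n) by (apply pow_lt; lra).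
  assert (Hbound : max_modulus F rho <= (8 * A + 16) * (M * (1 / 2) ^ n)).
  { apply max_modulus_le.
    { apply Rmult_le_pos; [lra|]. apply Rmult_le_pos; lra. }
    intros z Hz. destruct (Hw z) as [w [Hzw HwA]].
    assert (Hww : Cmod w <= rho + r0).
    { assert (H := Cmod_triangle_minus z (z - w)).
      replace (z - (z - w))%C with w in H by ring. lra. }
    (* [F] is bounded by [A] at distance 1 from [w] and by [M] at distance [4 * r0], which
       is at most [rho + 5 * r0] from the origin. *)
    assert (H3 := three_circles (fun y => F (1 * y + w)%C) (1 / 2) (2 * r0) A M q
      (z - w)%C n).
    cbv beta in H3. replace (1 * (z - w) + w)%C with z in H3 by ring.
    assert (H4 : Cmod (F z) <= 8 * A * q ^ n + 16 * M * (1 / 2) ^ n).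
    { apply H3; try (unfold q; lra).
      - intros y. apply cdiff_affine, HF.
      - intros y Hy. rewrite Cmult_1_l. apply HwA. lra.
      - intros y Hy. rewrite Cmult_1_l. apply (le_max_modulus F Hcont).
        eapply Rle_trans; [apply Cmod_triangle|]. lra. }
    assert (H5 : q ^ n <= M * (1 / 2) ^ n).
    { unfold Q in Hn1. rewrite Rpow_mult_distr in Hn1.
      apply Rmult_le_reg_l with (2 ^ n); [apply pow_lt; lra|].
      replace (2 ^ n * (M * (1 / 2) ^ n)) with (M * (2 ^ n * (1 / 2) ^ n)) by ring.
      rewrite <- (Rpow_mult_distr 2 (1 / 2)). replace (2 * (1 / 2)) with 1 by field.
      rewrite pow1. lra. }
    assert (H6 : 8 * A * q ^ n <= 8 * A * (M * (1 / 2) ^ n))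
      by (apply Rmult_le_compat_l; lra).
    lra. }
  assert (H1 : ln (max_modulus F rho) <= ln (8 * A + 16) + (ln M - INR n * ln 2)).
  { eapply Rle_trans; [apply ln_le; [|exact Hbound]; lra|].
    rewrite ln_mult, ln_mult by (try lra; apply Rmult_lt_0_compat; lra).
    rewrite ln_pow by lra. unfold Rdiv. rewrite Rmult_1_l, ln_Rinv by lra. lra. }
  assert (H2 : ln M < (INR n + 1) * ln Q).
  { apply ln_increasing in Hn2; [|lra]. rewrite ln_pow in Hn2 by (unfold Q, q; lra).
    now rewrite S_INR in Hn2. }
  assert (H3 : ln M / ln Q < INR n + 1).
  { apply (Rmult_lt_reg_r (ln Q)); [lra|]. unfold Rdiv.
    rewrite Rmult_assoc, Rinv_l by lra. lra. }
  replace ((1 - ln 2 / ln Q) * ln M) with (ln M - ln M / ln Q * ln 2) by (field; lra).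
  assert (ln M / ln Q * ln 2 <= (INR n + 1) * ln 2)
    by (apply Rmult_le_compat_r; lra).
  lra.
Qed.

Lemma exists_step (t s : R) : 0 <= t -> 0 < s ->
  exists j : nat, INR j * s <= t < (INR j + 1) * s.
Proof.
  intros Ht Hs. destruct (nfloor_ex (t / s)) as [j [Hj1 Hj2]].
  { apply Rmult_le_pos; [assumption | now apply Rlt_le, Rinv_0_lt_compat]. }
  exists j.
  apply (Rmult_le_compat_r s) in Hj1; [|lra].
  apply (Rmult_lt_compat_r s) in Hj2; [|lra].
  replace (t / s * s) with t in * by (field; lra). lra.
Qed.

(** Let [m = ln (max_modulus F)], and let [k] be the fixed point of the affine map
    [t => c + theta * t].  Then [m rho - k <= theta * (m (rho + s) - k)], and once [m - k]
    is positive, which happens by Liouville's theorem, it is multiplied by at least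
    [1 / theta] at each step of length [s]. *)
Theorem recurrent_growth_lower_bound (F : C -> C) : (forall z, cdiff F z) ->
  non_constant F -> locally_uniformly_recurrent F ->
  exists l T, 0 < l /\ forall t, T < t -> l <= loglog_rate F t.
Proof.
  intros HF Hnc Hrec.
  assert (Hcont : forall z, ccont F z) by (intros; apply cdiff_ccont, HF).
  destruct (log_max_modulus_contraction F HF Hrec) as
    (c & theta & s & Hc & Hth & Hs & Hstep).
  set (k := c / (1 - theta)).
  assert (Hk : 0 < k) by (apply Rdiv_lt_0_compat; lra).
  assert (Hk' : k * (1 - theta) = c) by (unfold k; field; lra).
  assert (Hstart : exists rho, 0 <= rho /\ exp (k + 1) <= max_modulus F rho).
  { apply NNPP. intros Hno. apply Hnc. exists (F 0%C).
    apply (liouville F (exp (k + 1)) HF). intros z.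
    assert (Hz := le_max_modulus F Hcont (Cmod z) z (Rle_refl _)).
    destruct (Rle_dec (exp (k + 1)) (max_modulus F (Cmod z))) as [H|H]; [|lra].
    exfalso. apply Hno. exists (Cmod z). split; [apply Cmod_ge_0 | assumption]. }
  destruct Hstart as [rho0 [Hrho0 Hstart]].
  set (lam := / theta).
  assert (Hlam : 1 < lam) by (unfold lam; rewrite <- Rinv_1; apply Rinv_lt_contravar; lra).
  assert (Hlam0 : 0 < ln lam) by (rewrite <- ln_1; apply ln_increasing; lra).
  assert (Hiter : forall j, lam ^ j <= ln (max_modulus F (rho0 + INR j * s)) - k).
  { induction j as [|j IH].
    - simpl. replace (rho0 + 0 * s) with rho0 by ring.
      apply ln_le in Hstart; [|apply exp_pos]. rewrite ln_exp in Hstart. lra.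
    - assert (Hj : 0 <= rho0 + INR j * s)
        by (assert (H := pos_INR j); nra).
      assert (Hmu : 1 <= max_modulus F (rho0 + INR j * s)).
      { assert (Hp : 1 <= lam ^ j) by (apply pow_R1_Rle; lra).
        apply Rnot_lt_le. intros Hlt.
        assert (H0 := max_modulus_ge_0 F Hcont _ Hj).
        destruct (Req_dec (max_modulus F (rho0 + INR j * s)) 0) as [E|E].
        - rewrite E in IH. unfold ln in IH. destruct (Rlt_dec 0 0); lra.
        - assert (H := ln_increasing (max_modulus F (rho0 + INR j * s)) 1
            ltac:(lra) Hlt). rewrite ln_1 in H. lra. }
      specialize (Hstep _ Hj Hmu).
      rewrite S_INR. replace (rho0 + (INR j + 1) * s) with (rho0 + INR j * s + s) by ring.
      set (m' := ln (max_modulus F (rho0 + INR j * s + s))) in *.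
      apply Rmult_le_reg_l with theta; [lra|].
      simpl. replace (theta * (lam * lam ^ j)) with (lam ^ j) by (unfold lam; field; lra).
      lra. }
  exists (ln lam / (2 * s)), (2 * rho0 + 2 * s + 1).
  split; [apply Rdiv_lt_0_compat; lra|].
  intros t Ht. unfold loglog_rate.
  destruct (exists_step (t - rho0) s) as [j [Hj1 Hj2]]; [lra | lra |].
  assert (Hjr : 0 <= INR j * s) by (apply Rmult_le_pos; [apply pos_INR | lra]).
  assert (Hpj : 0 < lam ^ j) by (apply pow_lt; lra).
  assert (H1 : lam ^ j <= ln (max_modulus F t)).
  { specialize (Hiter j).
    assert (Hpos : 0 < max_modulus F (rho0 + INR j * s)).
    { apply Rnot_le_lt. intros Hle.
      unfold ln in Hiter. destruct (Rlt_dec 0 _); lra. }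
    assert (Hm : max_modulus F (rho0 + INR j * s) <= max_modulus F t)
      by (apply (max_modulus_mono F Hcont); lra).
    apply ln_le in Hm; lra. }
  apply ln_le in H1; [|assumption]. rewrite ln_pow in H1 by lra.
  assert (H2 : t / (2 * s) <= INR j).
  { apply (Rmult_le_reg_r (2 * s)); [lra|]. unfold Rdiv.
    rewrite Rmult_assoc, Rinv_l by lra. lra. }
  apply (Rmult_le_reg_r t); [lra|].
  unfold Rdiv at 2. rewrite Rmult_assoc, Rinv_l by lra.
  replace (ln lam / (2 * s) * t) with (t / (2 * s) * ln lam) by (field; lra).
  assert (t / (2 * s) * ln lam <= INR j * ln lam) by (apply Rmult_le_compat_r; lra).
  lra.
Qed.

(** * Polynomials close to the indicator function of a half-plane *)

(** The point [i * shift N j] runs down the imaginary axis to the origin, which it reaches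
    for [j = N]. *)
Definition shift (N j : nat) : R := INR (N - j) / 5.

Lemma shift_ge_0 (N j : nat) : 0 <= shift N j.
Proof. unfold shift. assert (H := pos_INR (N - j)). lra. Qed.

Lemma shift_step (N j : nat) : shift N (S j) <= shift N j <= shift N (S j) + 1 / 5.
Proof.
  unfold shift. destruct (le_lt_dec N j) as [H|H].
  - replace (N - j)%nat with 0%nat by lia. replace (N - S j)%nat with 0%nat by lia.
    simpl. lra.
  - replace (N - j)%nat with (S (N - S j)) by lia. rewrite S_INR. lra.
Qed.

Lemma shift_le (N j : nat) : shift N j <= INR N / 5.
Proof.
  unfold shift. assert (H : INR (N - j) <= INR N) by (apply le_INR; lia). lra.
Qed.

Lemma shift_end (N j : nat) : (N <= j)%nat -> shift N j = 0.
Proof.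
  intros H. unfold shift. replace (N - j)%nat with 0%nat by lia. simpl. lra.
Qed.

Definition sqr_shift (N j : nat) (z : C) : C :=
  (z * z + RtoC (shift N j * shift N j))%C.

(** Newton's iteration for the inverse square root of [z ^ 2 + shift N j ^ 2]: one step
    after each move of the shift. *)
Fixpoint isqrt (N j : nat) (z : C) : C :=
  match j with
  | O => RtoC (5 / INR N)
  | S i => (isqrt N i z *
      (3 - sqr_shift N (S i) z * (isqrt N i z * isqrt N i z)) * / 2)%C
  end.

Definition isqrt_err (N j : nat) (z : C) : C :=
  (1 - sqr_shift N j z * (isqrt N j z * isqrt N j z))%C.

Lemma RtoC_2_neq_0 : RtoC 2 <> RtoC 0.
Proof. intros H. apply (f_equal fst) in H. simpl in H. lra. Qed.

(** Newton's iteration for the equation [Q * y ^ 2 = 1] converges quadratically. *)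
Lemma newton_error (Q y e : C) : e = (1 - Q * (y * y))%C ->
  (1 - Q * ((y * (3 - Q * (y * y)) * / 2) * (y * (3 - Q * (y * y)) * / 2)))%C =
  (e * e * (3 + e) * / 4)%C.
Proof.
  intros ->.
  replace (/ 4)%C with (/ 2 * / 2)%C.
  2:{ rewrite <- !RtoC_inv by lra. rewrite <- RtoC_mult. f_equal. field. }
  set (t := (/ 2)%C).
  assert (Ht : (2 * t)%C = RtoC 1) by (apply Cinv_r, RtoC_2_neq_0).
  replace (1 - Q * (y * (3 - Q * (y * y)) * t * (y * (3 - Q * (y * y)) * t)))%C with
    ((2 * t) * (2 * t) - Q * (y * (3 - Q * (y * y)) * t * (y * (3 - Q * (y * y)) * t)))%C
    by (rewrite Ht; ring).
  ring.
Qed.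

Lemma Cmod_newton_error (e : C) (d : R) : Cmod e <= d ->
  Cmod (e * e * (3 + e) * / 4) <= d * d * (3 + d) / 4.
Proof.
  intros He. assert (P := Cmod_ge_0 e).
  rewrite <- RtoC_inv, !Cmod_mult, Cmod_R by lra.
  rewrite (Rabs_pos_eq (/ 4)) by lra.
  assert (H := Cmod_triangle 3 e). rewrite Cmod_R, Rabs_pos_eq in H by lra.
  assert (Cmod e * Cmod e <= d * d) by nra.
  assert (0 <= Cmod (3 + e)) by apply Cmod_ge_0.
  assert (Cmod e * Cmod e * Cmod (3 + e) <= d * d * (3 + d))
    by (apply Rmult_le_compat; nra).
  lra.
Qed.

(** [|z ^ 2 + T ^ 2| = |z - i T| |z + i T|], where both factors are at least 1 and one of
    them at least [T]; the squares below make the constant slightly better. *)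
Lemma Cmod_sqr_shift_ge (z : C) (T : R) : 1 <= Rabs (fst z) -> 0 <= T ->
  2 * T <= Cmod (z * z + RtoC (T * T)) /\ 1 <= Cmod (z * z + RtoC (T * T)).
Proof.
  intros Hx HT. destruct z as [x y]. simpl in Hx.
  assert (Hxx : 1 <= x * x).
  { rewrite <- (Rabs_pos_eq (x * x)) by nra. rewrite Rabs_mult. nra. }
  unfold Cmod. simpl.
  replace ((x * x - y * y + T * T) * ((x * x - y * y + T * T) * 1) +
    (x * y + y * x + 0) * ((x * y + y * x + 0) * 1)) with
    ((y * y - T * T + x * x) * (y * y - T * T + x * x) + 4 * (T * T) * (x * x)) by ring.
  assert (0 <= T * T) by nra. assert (0 <= y * y) by nra.
  assert (Hsq : 0 <= (y * y - T * T + x * x) * (y * y - T * T + x * x))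
    by apply Rle_0_sqr.
  assert (HTx : T * T <= T * T * (x * x)) by nra.
  split.
  - apply Rsqr_incr_0_var; [|apply sqrt_pos]. rewrite Rsqr_sqrt by lra.
    unfold Rsqr. lra.
  - rewrite <- sqrt_1. apply sqrt_le_1_alt.
    assert (0 <= (y * y - T * T) * (y * y - T * T)) by apply Rle_0_sqr.
    assert (1 <= x * x * (x * x)) by nra.
    assert (0 <= x * x * (y * y + T * T)) by (apply Rmult_le_pos; lra).
    lra.
Qed.

(** The shift moves by at most 1/5, so its square moves by at most 2/5 of the shift, which
    is a fifth of the lower bound in [Cmod_sqr_shift_ge]. *)
Lemma isqrt_err_moved (N j : nat) (z : C) : 1 <= Rabs (fst z) ->
  Cmod (isqrt_err N j z) <= 1 / 4 ->
  Cmod (1 - sqr_shift N (S j) z * (isqrt N j z * isqrt N j z)) <= 1 / 2.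
Proof.
  intros Hx He.
  destruct (Cmod_sqr_shift_ge z (shift N j) Hx (shift_ge_0 N j)) as [H1 H2].
  set (T := shift N j) in *. set (T' := shift N (S j)).
  assert (HT : T' <= T <= T' + 1 / 5) by apply shift_step.
  assert (HT' : 0 <= T') by apply shift_ge_0.
  set (Y := isqrt N j z).
  assert (E : (1 - sqr_shift N (S j) z * (Y * Y))%C =
    (isqrt_err N j z + RtoC (T * T - T' * T') * (Y * Y))%C).
  { unfold isqrt_err, sqr_shift. fold Y T T'.
    rewrite RtoC_minus. ring. }
  rewrite E. eapply Rle_trans; [apply Cmod_triangle|].
  rewrite Cmod_mult, Cmod_R, Rabs_pos_eq by nra.
  assert (HQ : Cmod (sqr_shift N j z) * Cmod (Y * Y) <= 5 / 4).
  { rewrite <- Cmod_mult.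
    replace (sqr_shift N j z * (Y * Y))%C with (1 - isqrt_err N j z)%C
      by (unfold isqrt_err; fold Y; ring).
    eapply Rle_trans; [apply Cmod_triangle_minus|]. rewrite Cmod_1. lra. }
  assert (P := Cmod_ge_0 (Y * Y)).
  assert (H3 : T * T - T' * T' <= 1 / 5 * Cmod (sqr_shift N j z))
    by (unfold sqr_shift; fold T; nra).
  assert (H4 : (T * T - T' * T') * Cmod (Y * Y) <=
    1 / 5 * Cmod (sqr_shift N j z) * Cmod (Y * Y))
    by (apply Rmult_le_compat_r; assumption).
  lra.
Qed.

Lemma isqrt_err_S (N j : nat) (z : C) (d : R) :
  Cmod (1 - sqr_shift N (S j) z * (isqrt N j z * isqrt N j z)) <= d ->
  Cmod (isqrt_err N (S j) z) <= d * d * (3 + d) / 4.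
Proof.
  intros H. unfold isqrt_err. cbn [isqrt].
  rewrite (newton_error _ _ _ eq_refl). now apply Cmod_newton_error.
Qed.

(** Moving the shift raises the error from 1/4 to at most 1/2, and a Newton step brings it
    back below 1/4.  The start is a constant that is good enough because the shift is
    large compared with [z]. *)
Lemma isqrt_err_le (N j : nat) (z : C) : 1 <= Rabs (fst z) -> Cmod z <= INR N / 10 ->
  Cmod (isqrt_err N j z) <= 1 / 4.
Proof.
  intros Hx Hz. induction j as [|j IH].
  - assert (Hz1 := Rle_trans _ _ _ Hx (Rabs_fst_le_Cmod z)).
    unfold isqrt_err, sqr_shift, shift. cbn [isqrt]. rewrite Nat.sub_0_r.
    set (n := INR N) in *.
    replace (1 - (z * z + RtoC (n / 5 * (n / 5))) * (RtoC (5 / n) * RtoC (5 / n)))%C with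
      (- (z * z * RtoC (5 / n * (5 / n))))%C.
    2:{ rewrite <- RtoC_mult.
        replace (1 - (z * z + RtoC (n / 5 * (n / 5))) * RtoC (5 / n * (5 / n)))%C with
          (1 - RtoC (n / 5 * (n / 5)) * RtoC (5 / n * (5 / n)) -
            z * z * RtoC (5 / n * (5 / n)))%C by ring.
        rewrite <- RtoC_mult.
        replace (n / 5 * (n / 5) * (5 / n * (5 / n))) with 1 by (field; lra). ring. }
    rewrite Cmod_opp, !Cmod_mult, Cmod_R.
    assert (Hn : 0 < / n) by (apply Rinv_0_lt_compat; lra).
    rewrite Rabs_pos_eq.
    2:{ unfold Rdiv. nra. }
    apply Rle_trans with (n / 10 * (n / 10) * (5 / n * (5 / n))).
    + apply Rmult_le_compat_r; [unfold Rdiv; nra|].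
      apply Rmult_le_compat; try apply Cmod_ge_0; assumption.
    + right. field. lra.
  - eapply Rle_trans; [apply (isqrt_err_S N j z (1 / 2)), isqrt_err_moved; assumption|].
    lra.
Qed.

Lemma pow_2_S (m : nat) : (2 ^ S m = 2 ^ m + 2 ^ m)%nat.
Proof. simpl. lia. Qed.

(** Once the shift has reached the origin Newton's iteration converges quadratically. *)
Lemma isqrt_err_end (N m : nat) (z : C) : 1 <= Rabs (fst z) -> Cmod z <= INR N / 10 ->
  Cmod (isqrt_err N (N + m) z) <= (1 / 4) ^ (2 ^ m).
Proof.
  intros Hx Hz. induction m as [|m IH].
  - simpl. rewrite Rmult_1_r. now apply isqrt_err_le.
  - assert (H1 := isqrt_err_le N (N + m) z Hx Hz).
    rewrite Nat.add_succ_r.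
    assert (E : (1 - sqr_shift N (S (N + m)) z *
      (isqrt N (N + m) z * isqrt N (N + m) z))%C = isqrt_err N (N + m) z).
    { unfold isqrt_err, sqr_shift. rewrite !shift_end by lia. reflexivity. }
    assert (P := Cmod_ge_0 (isqrt_err N (N + m) z)).
    eapply Rle_trans; [apply (isqrt_err_S N (N + m) z (Cmod (isqrt_err N (N + m) z)));
      rewrite E; lra|].
    rewrite pow_2_S, pow_add. set (e := Cmod (isqrt_err N (N + m) z)) in *. nra.
Qed.

Lemma isqrt_opp (N j : nat) (z : C) : isqrt N j (- z)%C = isqrt N j z.
Proof.
  induction j as [|j IH]; [reflexivity|]. cbn [isqrt]. rewrite IH.
  unfold sqr_shift. replace (- z * - z)%C with (z * z)%C by ring. reflexivity.
Qed.

Lemma cdiff_isqrt (N j : nat) (z : C) : cdiff (isqrt N j) z.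
Proof.
  induction j as [|j IH].
  - apply (cdiff_const (RtoC (5 / INR N))).
  - cbn [isqrt]. apply (cdiff_mult (fun z => isqrt N j z * _)%C);
      [|apply (cdiff_const (/ 2)%C)].
    apply cdiff_mult; [exact IH|].
    apply cdiff_minus; [apply (cdiff_const 3)|].
    apply cdiff_mult; [|now apply cdiff_mult].
    unfold sqr_shift. apply cdiff_plus; [|apply cdiff_const].
    apply cdiff_mult; apply cdiff_id.
Qed.

Lemma isqrt_real_pos (N j : nat) (x : R) : 1 <= x -> x <= INR N / 10 ->
  exists y, 0 < y /\ isqrt N j (RtoC x) = RtoC y.
Proof.
  intros Hx HxN.
  assert (HC : Cmod (RtoC x) <= INR N / 10) by (rewrite Cmod_R, Rabs_pos_eq; lra).
  assert (HR : 1 <= Rabs (fst (RtoC x))) by (simpl; rewrite Rabs_pos_eq; lra).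
  induction j as [|j [y [Hy IH]]].
  - exists (5 / INR N). split; [apply Rdiv_lt_0_compat; lra | reflexivity].
  - assert (He := isqrt_err_moved N j (RtoC x) HR (isqrt_err_le N j _ HR HC)).
    cbn [isqrt]. rewrite IH in *. unfold sqr_shift in *.
    set (Q := x * x + shift N (S j) * shift N (S j)).
    assert (E : (1 - (RtoC x * RtoC x + RtoC (shift N (S j) * shift N (S j))) *
      (RtoC y * RtoC y))%C = RtoC (1 - Q * (y * y))).
    { unfold Q. rewrite RtoC_minus, !RtoC_mult, RtoC_plus, !RtoC_mult. ring. }
    rewrite E, Cmod_R in He. apply Rabs_le_between in He.
    exists (y * (3 - Q * (y * y)) / 2). split.
    + apply Rdiv_lt_0_compat; [|lra]. apply Rmult_lt_0_compat; lra.
    + unfold Rdiv, Q. rewrite !RtoC_mult, RtoC_inv by lra.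
      rewrite RtoC_minus, !RtoC_mult, RtoC_plus, !RtoC_mult. ring.
Qed.

(** [z * isqrt z] is close to one of [1] and [- 1], hence off the imaginary axis; on the
    right half of the domain, which is connected, its real part keeps the sign that it has
    on the real axis. *)
Lemma isqrt_right_half (N m : nat) (z : C) : 1 <= fst z -> Cmod z <= INR N / 10 ->
  0 < fst (z * isqrt N (N + m) z)%C.
Proof.
  intros Hx Hz. destruct z as [x y]. simpl fst in Hx.
  set (s := fun z => (z * isqrt N (N + m) z)%C).
  set (phi := fun t => fst (s (x, t * y))).
  assert (Hs : forall z, ccont s z).
  { intros z. apply cdiff_ccont, (cdiff_mult (fun z => z));
      [apply cdiff_id | apply cdiff_isqrt]. }
  assert (Hphi : continuity phi).
  { intros t. apply continuity_pt_filterlim.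
    apply (filterlim_locally (F := locally t)). intros eps.
    destruct (Hs (x, t * y) eps (cond_pos eps)) as [d [Hd0 Hd]].
    assert (Hpy := Rabs_pos y).
    assert (Hd1 : 0 < d / (1 + Rabs y)) by (apply Rdiv_lt_0_compat; lra).
    exists (mkposreal _ Hd1). intros t' Ht'.
    change (Rabs (t' - t) < d / (1 + Rabs y)) in Ht'.
    change (Rabs (phi t' - phi t) < eps).
    eapply Rle_lt_trans; [apply (Rabs_fst_le_Cmod (s (x, t' * y)%R - s (x, t * y)%R))|].
    apply Hd.
    replace ((x, (t' * y)%R) - (x, (t * y)%R))%C with (Ci * RtoC ((t' - t) * y))%C
      by (apply injective_projections; simpl; ring).
    rewrite Cmod_mult, Cmod_Ci, Cmod_R, Rabs_mult, Rmult_1_l.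
    apply (Rmult_lt_compat_r (1 + Rabs y)) in Ht'; [|lra].
    replace (d / (1 + Rabs y) * (1 + Rabs y)) with d in Ht' by (field; lra).
    assert (H := Rabs_pos (t' - t)). nra. }
  assert (Hxz : x <= Cmod (x, y))
    by (eapply Rle_trans; [apply Rle_abs | apply (Rabs_fst_le_Cmod (x, y))]).
  assert (H0 : 0 < phi 0).
  { unfold phi, s. destruct (isqrt_real_pos N (N + m) x Hx ltac:(lra)) as [v [Hv E]].
    replace ((x, 0 * y) : C) with (RtoC x)
      by (apply injective_projections; simpl; ring).
    rewrite E. simpl. nra. }
  apply Rnot_le_lt. intros Hneg.
  assert (H1 : phi 1 <= 0) by (unfold phi, s; now rewrite Rmult_1_l).
  destruct (IVT_gen phi 0 1 0 Hphi) as [t [Ht Hroot]].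
  { split; [eapply Rle_trans; [apply Rmin_r | lra] |
      eapply Rle_trans; [|apply Rmax_l]; lra]. }
  rewrite Rmin_left, Rmax_right in Ht by lra.
  assert (Hzt : Cmod (x, t * y) <= INR N / 10).
  { eapply Rle_trans; [|exact Hz]. unfold Cmod. apply sqrt_le_1_alt. simpl.
    assert (t * t <= 1) by nra. assert (0 <= y * y) by nra. nra. }
  assert (He := isqrt_err_le N (N + m) (x, t * y)
    ltac:(simpl; rewrite Rabs_pos_eq; lra) Hzt).
  unfold isqrt_err, sqr_shift in He. rewrite shift_end in He by lia.
  unfold phi, s in Hroot. set (Y := isqrt N (N + m) (x, t * y)) in *.
  set (w := ((x, (t * y)%R) * Y)%C) in *.
  change (fst w = 0) in Hroot.
  match type of He with Cmod ?e <= _ => replace e with (1 - w * w)%C in He end.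
  2:{ unfold w. replace (RtoC (0 * 0)) with (RtoC 0) by (f_equal; ring). ring. }
  clearbody w.
  assert (H2 := Rabs_fst_le_Cmod (1 - w * w)). simpl in H2. rewrite Hroot in H2.
  assert (H3 := Rle_abs (1 + - (0 * 0 - snd w * snd w))).
  assert (0 <= snd w * snd w) by apply Rle_0_sqr.
  lra.
Qed.

(** Since the shift has reached the origin, [z * isqrt z] approximates [z / sqrt (z ^ 2)],
    the sign of the real part. *)
Definition halfplane (N m : nat) (z : C) : C := ((1 + z * isqrt N (N + m) z) * / 2)%C.

Lemma cdiff_heav (N m : nat) (z : C) : cdiff (halfplane N m) z.
Proof.
  apply (cdiff_mult (fun z => 1 + z * isqrt N (N + m) z)%C); [|apply (cdiff_const (/ 2)%C)].
  apply cdiff_plus; [apply (cdiff_const 1)|].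
  apply (cdiff_mult (fun z => z)); [apply cdiff_id | apply cdiff_isqrt].
Qed.

Lemma halfplane_right (N m : nat) (z : C) : 1 <= fst z -> Cmod z <= INR N / 10 ->
  Cmod (halfplane N m z - 1) <= (1 / 4) ^ (2 ^ m).
Proof.
  intros Hx Hz.
  assert (Hpos := isqrt_right_half N m z Hx Hz).
  assert (He := isqrt_err_end N m z ltac:(rewrite Rabs_pos_eq; lra) Hz).
  unfold isqrt_err, sqr_shift in He. rewrite shift_end in He by lia.
  unfold halfplane. set (Y := isqrt N (N + m) z) in *. set (w := (z * Y)%C) in *.
  match type of He with Cmod ?e <= _ => replace e with (- ((w - 1) * (w + 1)))%C in He end.
  2:{ unfold w. replace (RtoC (0 * 0)) with (RtoC 0) by (f_equal; ring). ring. }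
  clearbody w. rewrite Cmod_opp, Cmod_mult in He.
  assert (H1 : 1 <= Cmod (w + 1)).
  { eapply Rle_trans; [|apply Rabs_fst_le_Cmod]. simpl.
    eapply Rle_trans; [|apply Rle_abs]. lra. }
  replace ((1 + w) * / 2 - 1)%C with ((w - 1) * / 2)%C
    by (field; apply RtoC_2_neq_0).
  rewrite Cmod_mult, Cmod_inv by apply RtoC_2_neq_0.
  rewrite Cmod_R, (Rabs_pos_eq 2) by lra.
  assert (P := Cmod_ge_0 (w - 1)). nra.
Qed.

Lemma halfplane_left (N m : nat) (z : C) : fst z <= -1 -> Cmod z <= INR N / 10 ->
  Cmod (halfplane N m z) <= (1 / 4) ^ (2 ^ m).
Proof.
  intros Hx Hz.
  assert (H := halfplane_right N m (- z)%C ltac:(simpl; lra) ltac:(now rewrite Cmod_opp)).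
  rewrite <- (Cmod_opp (halfplane N m z)).
  replace (- halfplane N m z)%C with (halfplane N m (- z) - 1)%C; [assumption|].
  unfold halfplane. rewrite isqrt_opp. field.
Qed.

(** A Newton step at most triples the degree; the factor [Om ^ 2] absorbs the additive
    terms of the recursion. *)
Lemma isqrt_growth (N j : nat) (z : C) (Om : R) : (5 <= N)%nat ->
  2 + Cmod z + INR N / 5 <= Om ->
  Cmod (isqrt N j z) * (Om * Om) <= Om ^ (2 * 3 ^ j).
Proof.
  intros HN HOm. assert (P := Cmod_ge_0 z).
  assert (HN' : 5 <= INR N) by (replace 5 with (INR 5) by (simpl; lra); now apply le_INR).
  assert (HOm3 : 3 <= Om) by lra.
  induction j as [|j IH].
  - simpl. rewrite Cmod_R, Rabs_pos_eq.
    2:{ apply Rlt_le, Rdiv_lt_0_compat; lra. }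
    assert (5 / INR N <= 1).
    { apply (Rmult_le_reg_r (INR N)); [lra|]. unfold Rdiv.
      rewrite Rmult_assoc, Rinv_l; lra. }
    assert (0 <= Om * Om) by nra. nra.
  - set (n := (2 * 3 ^ j)%nat) in *.
    replace (2 * 3 ^ S j)%nat with (n + n + n)%nat by (unfold n; simpl; lia).
    rewrite !pow_add.
    assert (HU : Om * Om <= Om ^ n).
    { replace (Om * Om) with (Om ^ 2) by ring. apply Rle_pow; [lra|].
      unfold n. assert (H := Nat.pow_nonzero 3 j). lia. }
    set (U := Om ^ n) in *.
    cbn [isqrt]. set (Y := isqrt N j z) in *.
    rewrite !Cmod_mult, Cmod_inv by apply RtoC_2_neq_0.
    rewrite Cmod_R, (Rabs_pos_eq 2) by lra.
    assert (PY := Cmod_ge_0 Y). set (t := Cmod Y) in *.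
    assert (HQ : Cmod (sqr_shift N (S j) z) <= Om * Om).
    { unfold sqr_shift. eapply Rle_trans; [apply Cmod_triangle|].
      assert (H1 := shift_ge_0 N (S j)). assert (H2 := shift_le N (S j)).
      rewrite Cmod_mult, Cmod_R, Rabs_pos_eq by nra.
      assert (shift N (S j) * shift N (S j) <= INR N / 5 * (INR N / 5)) by nra.
      nra. }
    assert (H3 : Cmod (3 - sqr_shift N (S j) z * (Y * Y)) <= 3 + Om * Om * (t * t)).
    { eapply Rle_trans; [apply Cmod_triangle_minus|].
      rewrite Cmod_R, Rabs_pos_eq, !Cmod_mult by lra. fold t.
      apply Rplus_le_compat_l, Rmult_le_compat_r; nra. }
    set (W := Cmod (3 - sqr_shift N (S j) z * (Y * Y))) in *.
    assert (H4 : t * t * (Om * Om) <= U * U).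
    { assert (HOO : 9 <= Om * Om) by nra.
      assert (t <= t * (Om * Om))
        by (rewrite <- (Rmult_1_r t) at 1; apply Rmult_le_compat_l; lra).
      assert (0 <= t * (Om * Om)) by (apply Rmult_le_pos; lra).
      replace (t * t * (Om * Om)) with (t * (t * (Om * Om))) by ring.
      apply Rmult_le_compat; lra. }
    assert (H5 : W <= 2 * (U * U)).
    { assert (9 <= U) by nra. nra. }
    replace (t * W * / 2 * (Om * Om)) with (t * (Om * Om) * W / 2) by field.
    assert (HW : 0 <= W) by apply Cmod_ge_0.
    assert (t * (Om * Om) * W <= U * (2 * (U * U))).
    { apply Rmult_le_compat; try assumption. nra. }
    lra.
Qed.

Lemma halfplane_growth (N m : nat) (z : C) (Om : R) : (5 <= N)%nat ->
  2 + Cmod z + INR N / 5 <= Om ->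
  Cmod (halfplane N m z) <= Om ^ (2 * 3 ^ (N + m)).
Proof.
  intros HN HOm. assert (P := Cmod_ge_0 z).
  assert (HY := isqrt_growth N (N + m) z Om HN HOm).
  assert (HOm2 : 2 <= Om) by (assert (H := pos_INR N); lra).
  assert (HU : 1 <= Om ^ (2 * 3 ^ (N + m))) by (apply pow_R1_Rle; lra).
  unfold halfplane. set (U := Om ^ (2 * 3 ^ (N + m))) in *.
  rewrite Cmod_mult, Cmod_inv by apply RtoC_2_neq_0.
  rewrite Cmod_R, (Rabs_pos_eq 2) by lra.
  assert (H1 : Cmod (1 + z * isqrt N (N + m) z) <= 1 + U).
  { eapply Rle_trans; [apply Cmod_triangle|]. rewrite Cmod_1, Cmod_mult.
    assert (PY := Cmod_ge_0 (isqrt N (N + m) z)).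
    assert (Cmod z <= Om * Om) by (assert (H := pos_INR N); nra).
    assert (Cmod z * Cmod (isqrt N (N + m) z) <= Om * Om * Cmod (isqrt N (N + m) z))
      by (apply Rmult_le_compat_r; assumption).
    lra. }
  lra.
Qed.

(** * Polynomials close to the indicator function of one square of a grid *)

(** Four half-planes cut out the square of side [p] centred at the origin, with a margin of
    width 1 inside and outside of its boundary. *)
Definition bump (N m : nat) (p : R) (z : C) : C :=
  ((halfplane N m (1 * z + RtoC (p / 2)) * halfplane N m (- (1) * z + RtoC (p / 2))) *
   (halfplane N m (Ci * z + RtoC (p / 2)) * halfplane N m (- Ci * z + RtoC (p / 2))))%C.

Lemma cdiff_bump (N m : nat) (p : R) (z : C) : cdiff (bump N m p) z.
Proof.
  assert (H : forall a, cdiff (fun z => halfplane N m (a * z + RtoC (p / 2)))%C z)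
    by (intros a; apply cdiff_affine, cdiff_heav).
  apply (cdiff_mult (fun z => halfplane N m (1 * z + RtoC (p / 2)) *
    halfplane N m (- (1) * z + RtoC (p / 2)))%C (fun z => halfplane N m (Ci * z + RtoC (p / 2)) *
    halfplane N m (- Ci * z + RtoC (p / 2)))%C);
  apply cdiff_mult; apply H.
Qed.

Lemma Cmod_mult_near (a b d : R) (x y : C) : 0 <= a <= 1 -> 0 <= b <= 1 ->
  d <= 1 -> Cmod (x - RtoC a) <= d -> Cmod (y - RtoC b) <= d ->
  Cmod (x * y - RtoC (a * b)) <= 3 * d.
Proof.
  intros Ha Hb Hd Hx Hy.
  replace (x * y - RtoC (a * b))%C with
    ((x - RtoC a) * (y - RtoC b) + RtoC b * (x - RtoC a) + RtoC a * (y - RtoC b))%C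
    by (rewrite RtoC_mult; ring).
  eapply Rle_trans; [apply Cmod_triangle|].
  eapply Rle_trans; [apply Rplus_le_compat_r, Cmod_triangle|].
  rewrite !Cmod_mult, !Cmod_R, !Rabs_pos_eq by lra.
  assert (P1 := Cmod_ge_0 (x - RtoC a)). assert (P2 := Cmod_ge_0 (y - RtoC b)).
  nra.
Qed.

(** Which of the values 0 and 1 a half-plane takes on the squares of index [i] in a row. *)
Definition ind (i : Z) : R := if (0 <=? i)%Z then 1 else 0.

Lemma ind_bounds (i : Z) : 0 <= ind i <= 1.
Proof. unfold ind. destruct (0 <=? i)%Z; lra. Qed.

Definition delta0 (i j : Z) : R := if (Z.eqb i 0 && Z.eqb j 0)%bool then 1 else 0.

Lemma delta0_ind (i j : Z) :
  delta0 i j = (ind i * ind (- i)) * (ind (- j) * ind j).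
Proof.
  unfold delta0, ind.
  destruct (Z.eqb_spec i 0), (Z.eqb_spec j 0), (Z.leb_spec 0 i), (Z.leb_spec 0 (- i)),
    (Z.leb_spec 0 j), (Z.leb_spec 0 (- j)); simpl; lia || lra.
Qed.

(** [halfplane] jumps between the squares with indices [-1] and [0] of a row. *)
Lemma halfplane_grid (N m : nat) (p x : R) (i : Z) (z : C) : 0 <= p ->
  Rabs x <= p / 2 - 1 -> fst z = x + IZR i * p -> Cmod z <= 5 * p -> 60 * p <= INR N ->
  Cmod (halfplane N m (z + RtoC (p / 2)) - RtoC (ind i)) <= (1 / 4) ^ (2 ^ m).
Proof.
  intros Hp Hx Hz Hz5 HN. apply Rabs_le_between in Hx.
  assert (Hmod : Cmod (z + RtoC (p / 2)) <= INR N / 10).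
  { eapply Rle_trans; [apply Cmod_triangle|]. rewrite Cmod_R, Rabs_pos_eq; lra. }
  unfold ind. destruct (Z.leb_spec 0 i) as [Hi|Hi].
  - apply halfplane_right; [|assumption]. simpl. rewrite Hz.
    apply IZR_le in Hi. nra.
  - replace (halfplane N m (z + RtoC (p / 2)) - 0)%C with (halfplane N m (z + RtoC (p / 2)))
      by ring.
    apply halfplane_left; [|assumption]. simpl. rewrite Hz.
    assert (Hi' : (i <= -1)%Z) by lia. apply IZR_le in Hi'. nra.
Qed.

Lemma bump_grid (N m : nat) (p x y : R) (i j : Z) : 0 <= p ->
  Rabs x <= p / 2 - 1 -> Rabs y <= p / 2 - 1 ->
  (-2 <= i <= 2)%Z -> (-2 <= j <= 2)%Z -> 60 * p <= INR N ->
  3 * (1 / 4) ^ (2 ^ m) <= 1 ->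
  Cmod (bump N m p (x + IZR i * p, y + IZR j * p) - RtoC (delta0 i j)) <=
    9 * (1 / 4) ^ (2 ^ m).
Proof.
  intros Hp Hx Hy Hi Hj HN Heta.
  set (eta := (1 / 4) ^ (2 ^ m)) in *.
  assert (Heta0 : 0 < eta) by (apply pow_lt; lra).
  assert (Hmod : Cmod (x + IZR i * p, y + IZR j * p) <= 5 * p).
  { eapply Rle_trans; [apply Cmod_Rabs_le|].
    destruct Hi as [Hi1 Hi2]. destruct Hj as [Hj1 Hj2].
    apply IZR_le in Hi1, Hi2, Hj1, Hj2.
    apply Rabs_le_between in Hx, Hy.
    assert (Rabs (x + IZR i * p) <= 5 / 2 * p) by (apply Rabs_le; nra).
    assert (Rabs (y + IZR j * p) <= 5 / 2 * p) by (apply Rabs_le; nra).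
    lra. }
  set (z := ((x + IZR i * p, y + IZR j * p) : C)) in *.
  assert (H1 : Cmod (halfplane N m (1 * z + RtoC (p / 2)) - RtoC (ind i)) <= eta).
  { apply (halfplane_grid N m p x i); try assumption.
    - simpl. ring.
    - now rewrite Cmod_mult, Cmod_1, Rmult_1_l. }
  assert (H2 : Cmod (halfplane N m (- (1) * z + RtoC (p / 2)) - RtoC (ind (- i))) <= eta).
  { apply (halfplane_grid N m p (- x) (- i)); try assumption.
    - now rewrite Rabs_Ropp.
    - rewrite opp_IZR. simpl. ring.
    - now rewrite Cmod_mult, Cmod_opp, Cmod_1, Rmult_1_l. }
  assert (H3 : Cmod (halfplane N m (Ci * z + RtoC (p / 2)) - RtoC (ind (- j))) <= eta).
  { apply (halfplane_grid N m p (- y) (- j)); try assumption.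
    - now rewrite Rabs_Ropp.
    - rewrite opp_IZR. simpl. ring.
    - now rewrite Cmod_mult, Cmod_Ci, Rmult_1_l. }
  assert (H4 : Cmod (halfplane N m (- Ci * z + RtoC (p / 2)) - RtoC (ind j)) <= eta).
  { apply (halfplane_grid N m p y j); try assumption.
    - simpl. ring.
    - now rewrite Cmod_mult, Cmod_opp, Cmod_Ci, Rmult_1_l. }
  rewrite delta0_ind. unfold bump.
  assert (B := ind_bounds i). assert (B' := ind_bounds (- i)).
  assert (D := ind_bounds j). assert (D' := ind_bounds (- j)).
  replace (9 * eta) with (3 * (3 * eta)) by ring.
  apply Cmod_mult_near; try nra; apply Cmod_mult_near; lra || assumption.
Qed.

Lemma bump_growth (N m : nat) (p : R) (z : C) (Om : R) : (5 <= N)%nat -> 0 <= p ->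
  2 + Cmod z + p / 2 + INR N / 5 <= Om ->
  Cmod (bump N m p z) <= Om ^ (8 * 3 ^ (N + m)).
Proof.
  intros HN Hp HOm.
  assert (H : forall a, Cmod a = 1 ->
    Cmod (halfplane N m (a * z + RtoC (p / 2))) <= Om ^ (2 * 3 ^ (N + m))).
  { intros a Ha. apply halfplane_growth; [assumption|].
    assert (H := Cmod_triangle (a * z) (RtoC (p / 2))).
    rewrite Cmod_mult, Ha, Cmod_R, Rabs_pos_eq in H by lra. lra. }
  assert (H1 := H 1%C Cmod_1).
  assert (H2 := H (- (1))%C ltac:(now rewrite Cmod_opp, Cmod_1)).
  assert (H3 := H Ci Cmod_Ci).
  assert (H4 := H (- Ci)%C ltac:(now rewrite Cmod_opp, Cmod_Ci)).
  unfold bump. rewrite !Cmod_mult.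
  replace (8 * 3 ^ (N + m))%nat with
    ((2 * 3 ^ (N + m) + 2 * 3 ^ (N + m)) + (2 * 3 ^ (N + m) + 2 * 3 ^ (N + m)))%nat by lia.
  rewrite !(pow_add Om).
  apply Rmult_le_compat; try (apply Rmult_le_pos; apply Cmod_ge_0);
    apply Rmult_le_compat; try apply Cmod_ge_0; assumption.
Qed.

(** * The hierarchical construction *)

Definition sum3 (f : Z -> C) : C := (f (-1)%Z + f 0%Z + f 1%Z)%C.

Lemma sum3_bound (f : Z -> C) (e : R) :
  (forall i, (-1 <= i <= 1)%Z -> Cmod (f i) <= e) -> Cmod (sum3 f) <= 3 * e.
Proof.
  intros H. unfold sum3.
  eapply Rle_trans; [apply Cmod_triangle|].
  eapply Rle_trans; [apply Rplus_le_compat_r, Cmod_triangle|].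
  assert (H1 := H (-1)%Z ltac:(lia)). assert (H2 := H 0%Z ltac:(lia)).
  assert (H3 := H 1%Z ltac:(lia)). lra.
Qed.

Lemma sum3_close (f h : Z -> C) (e : R) :
  (forall i, (-1 <= i <= 1)%Z -> Cmod (f i - h i) <= e) ->
  Cmod (sum3 f - sum3 h) <= 3 * e.
Proof.
  intros H.
  replace (sum3 f - sum3 h)%C with (sum3 (fun i => f i - h i)%C) by (unfold sum3; ring).
  now apply sum3_bound.
Qed.

Definition pitch (k : nat) : R := 4 * 3 ^ k.

Definition node (k : nat) (i j : Z) : C := (IZR i * pitch k, IZR j * pitch k).

(** Neighbouring translates by [node k] are separated by gaps of width 2, whatever [k] is:
    the pattern of level [k] must return within a distance that depends on [k] alone, so
    the gaps of the higher levels cannot widen. *)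
Definition in_square (k : nat) (z : C) : Prop :=
  Rabs (fst z) <= pitch k / 2 - 1 /\ Rabs (snd z) <= pitch k / 2 - 1.

(** The growth of [tower k] is measured by the degree [3 ^ (250 * 3 ^ k)].  The half-plane
    polynomials are evaluated at points of modulus at most [6 * pitch k], a tenth of the
    number of moves.  The error of [tile k] is about [(1 / 4) ^ (2 ^ (506 * 3 ^ k))], and
    [2 ^ 506 > 4 ^ 250 > 3 ^ 250] makes it small even when multiplied by [tower k].  The
    degree of [tile k] is about [3 ^ ((240 + 506) * 3 ^ k)], and [746 + 3 <= 3 * 250] gives
    the degree of [tower (S k)].  A Newton step triples the degree and only doubles the
    number of correct digits, so accuracy alone squares the degree of [tower k]; the next
    level, three times as large, allows for its cube. *)
Definition moves (k : nat) : nat := 240 * 3 ^ k.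
Definition refinements (k : nat) : nat := 506 * 3 ^ k.

Definition tile (k : nat) (z : C) : C := bump (moves k) (refinements k) (pitch k) z.

Fixpoint tower (k : nat) (z : C) : C :=
  match k with
  | O => z
  | S l => sum3 (fun i => sum3 (fun j =>
      tile l (z - node l i j) * tower l (z - node l i j)))%C
  end.

Definition tower_degree (k : nat) : nat := 3 ^ (250 * 3 ^ k).

Lemma pow3_ge_1 (k : nat) : 1 <= 3 ^ k.
Proof. apply pow_R1_Rle. lra. Qed.

Lemma INR_pow3 (k : nat) : INR (3 ^ k) = 3 ^ k.
Proof. rewrite pow_INR. f_equal. simpl. lra. Qed.

Lemma INR_moves (k : nat) : INR (moves k) = 60 * pitch k.
Proof.
  unfold moves, pitch. rewrite mult_INR, INR_pow3, (INR_IZR_INZ 240). simpl. ring.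
Qed.

Lemma pitch_ge_4 (k : nat) : 4 <= pitch k.
Proof. unfold pitch. assert (H := pow3_ge_1 k). lra. Qed.

Lemma pitch_S (k : nat) : pitch (S k) = 3 * pitch k.
Proof. unfold pitch. simpl. ring. Qed.

Lemma node_0 (k : nat) : node k 0 0 = RtoC 0.
Proof. apply injective_projections; simpl; ring. Qed.

Lemma Cmod_node (k : nat) (i j : Z) : (-1 <= i <= 1)%Z -> (-1 <= j <= 1)%Z ->
  Cmod (node k i j) <= 2 * pitch k.
Proof.
  intros [Hi1 Hi2] [Hj1 Hj2]. apply IZR_le in Hi1, Hi2, Hj1, Hj2.
  assert (P := pitch_ge_4 k).
  eapply Rle_trans; [apply Cmod_Rabs_le|].
  assert (Rabs (IZR i * pitch k) <= pitch k) by (apply Rabs_le; nra).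
  assert (Rabs (IZR j * pitch k) <= pitch k) by (apply Rabs_le; nra).
  lra.
Qed.

Lemma cdiff_shift (F : C -> C) (w z : C) : (forall z, cdiff F z) ->
  cdiff (fun y => F (y - w)%C) z.
Proof.
  intros HF. apply (cdiff_ext (fun y => F (1 * y + - w)%C)).
  - intros y. f_equal. ring.
  - apply cdiff_affine, HF.
Qed.

Lemma cdiff_sum3 (f : Z -> C -> C) (z : C) : (forall i, cdiff (f i) z) ->
  cdiff (fun y => sum3 (fun i => f i y)) z.
Proof.
  intros H. apply (cdiff_plus (fun y => f (-1)%Z y + f 0%Z y)%C); [|apply H].
  apply cdiff_plus; apply H.
Qed.

Lemma cdiff_tower (k : nat) (z : C) : cdiff (tower k) z.
Proof.
  revert z. induction k as [|k IH]; intros z.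
  - apply cdiff_id.
  - apply (cdiff_sum3 (fun i y => sum3 (fun j =>
      tile k (y - node k i j) * tower k (y - node k i j)))%C). intros i.
    apply (cdiff_sum3 (fun j y =>
      tile k (y - node k i j) * tower k (y - node k i j))%C). intros j.
    apply (cdiff_mult (fun y => tile k (y - node k i j)%C)
      (fun y => tower k (y - node k i j)%C)).
    + apply (cdiff_shift (tile k)). intros y. apply cdiff_bump.
    + now apply cdiff_shift.
Qed.

Lemma pow3_nat_pos (n : nat) : (1 <= 3 ^ n)%nat.
Proof. assert (H := Nat.pow_nonzero 3 n). lia. Qed.

Lemma tower_degree_pos (k : nat) : (1 <= tower_degree k)%nat.
Proof. apply pow3_nat_pos. Qed.

Lemma tower_degree_S (k : nat) :
  (8 * 3 ^ (moves k + refinements k) + tower_degree k + 2 <= tower_degree (S k))%nat.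
Proof.
  unfold tower_degree, moves, refinements.
  rewrite Nat.pow_succ_r'. assert (Hq := pow3_nat_pos k).
  set (q := (3 ^ k)%nat) in *.
  replace (240 * q + 506 * q)%nat with (746 * q)%nat by lia.
  assert (H1 : (3 ^ (250 * q) <= 3 ^ (746 * q))%nat) by (apply Nat.pow_le_mono_r; lia).
  assert (H2 : (3 ^ (746 * q + 3) <= 3 ^ (250 * (3 * q)))%nat)
    by (apply Nat.pow_le_mono_r; lia).
  assert (H3 : (1 <= 3 ^ (746 * q))%nat) by apply pow3_nat_pos.
  rewrite Nat.pow_add_r in H2. change (3 ^ 3)%nat with 27%nat in H2.
  set (a := (3 ^ (746 * q))%nat) in *. clearbody a. lia.
Qed.

Lemma tower_growth (k : nat) (z : C) (Om : R) : 60 * 3 ^ k + Cmod z <= Om ->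
  Cmod (tower k z) <= Om ^ tower_degree k.
Proof.
  revert z Om. induction k as [|k IH]; intros z Om HOm.
  - assert (P := Cmod_ge_0 z). simpl in HOm. cbn [tower].
    apply Rle_trans with (Om ^ 1); [lra|].
    apply Rle_pow; [lra | apply tower_degree_pos].
  - assert (P := Cmod_ge_0 z). assert (Hq := pow3_ge_1 k).
    rewrite <- tech_pow_Rmult in HOm.
    assert (HOm3 : 3 <= Om) by lra.
    assert (Hterm : forall i j, (-1 <= i <= 1)%Z -> (-1 <= j <= 1)%Z ->
      Cmod (tile k (z - node k i j) * tower k (z - node k i j)) <=
      Om ^ (8 * 3 ^ (moves k + refinements k)) * Om ^ tower_degree k).
    { intros i j Hi Hj.
      assert (Hn := Cmod_node k i j Hi Hj).
      assert (Hzn := Cmod_triangle_minus z (node k i j)).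
      rewrite Cmod_mult. unfold pitch in Hn.
      apply Rmult_le_compat; try apply Cmod_ge_0.
      - apply bump_growth.
        + unfold moves. assert (H := pow3_nat_pos k). lia.
        + unfold pitch. lra.
        + rewrite INR_moves. unfold pitch. lra.
      - apply IH. lra. }
    cbn [tower].
    eapply Rle_trans.
    { apply sum3_bound. intros i Hi. apply sum3_bound. intros j Hj.
      apply Hterm; assumption. }
    rewrite <- pow_add.
    set (n := (8 * 3 ^ (moves k + refinements k) + tower_degree k)%nat).
    assert (Hn : 0 < Om ^ n) by (apply pow_lt; lra).
    apply Rle_trans with (Om ^ (n + 2)).
    + rewrite pow_add. set (U := Om ^ n) in *. clearbody U.
      replace (Om ^ 2) with (Om * Om) by ring.
      assert (9 <= Om * Om) by nra. nra.
    + apply Rle_pow; [lra | apply tower_degree_S].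
Qed.

Lemma refinements_enough_nat (q k : nat) : (1 <= q)%nat -> (k <= q)%nat ->
  (10 + k + (7 + 2 * k) * 3 ^ (250 * q) <= 2 * 2 ^ (506 * q))%nat.
Proof.
  intros Hq Hk.
  assert (H1 : (3 ^ (250 * q) <= 2 ^ (500 * q))%nat).
  { replace (500 * q)%nat with (2 * (250 * q))%nat by lia.
    rewrite (Nat.pow_mul_r 2 2). apply Nat.pow_le_mono_l. simpl. lia. }
  assert (H2 : (20 * q <= 2 ^ (6 * q))%nat).
  { rewrite Nat.pow_mul_r. change (2 ^ 6)%nat with 64%nat. clear.
    induction q as [|q IH]; [simpl; lia|].
    rewrite Nat.pow_succ_r'. assert (1 <= 64 ^ q)%nat
      by (assert (H := Nat.pow_nonzero 64 q); lia). lia. }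
  replace (506 * q)%nat with (6 * q + 500 * q)%nat by lia. rewrite Nat.pow_add_r.
  assert (H3 : (1 <= 2 ^ (500 * q))%nat)
    by (assert (H := Nat.pow_nonzero 2 (500 * q)); lia).
  set (a := (3 ^ (250 * q))%nat) in *. set (b := (2 ^ (500 * q))%nat) in *.
  set (c := (2 ^ (6 * q))%nat) in *. clearbody a b c. nia.
Qed.

Lemma le_pow3 (k : nat) : (k <= 3 ^ k)%nat.
Proof. assert (H := Nat.pow_gt_lin_r 3 k). lia. Qed.

Lemma half_pow_mono (a b : nat) : (a <= b)%nat -> (1 / 2) ^ b <= (1 / 2) ^ a.
Proof.
  intros H. replace b with (a + (b - a))%nat by lia. rewrite pow_add.
  assert (P : 0 < (1 / 2) ^ a) by (apply pow_lt; lra).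
  assert (Q := pow_incr (1 / 2) 1 (b - a) ltac:(lra)). rewrite pow1 in Q.
  nra.
Qed.

(** The accuracy of [tile k] beats the size of [tower k] on the squares that its
    translates have to suppress. *)
Lemma refinements_enough (k : nat) :
  9 * (9 * (1 / 4) ^ (2 ^ refinements k) * (80 * 3 ^ k) ^ tower_degree k) <=
    (1 / 2) ^ (k + 3).
Proof.
  assert (Hnat := refinements_enough_nat (3 ^ k) k (pow3_nat_pos k) (le_pow3 k)).
  change (506 * 3 ^ k)%nat with (refinements k) in Hnat.
  change (3 ^ (250 * 3 ^ k))%nat with (tower_degree k) in Hnat.
  set (D := tower_degree k) in *. set (X := (2 ^ refinements k)%nat) in *.
  assert (Hq := pow3_ge_1 k).
  assert (H1 : (80 * 3 ^ k) ^ D <= 2 ^ ((7 + 2 * k) * D)).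
  { rewrite pow_mult. apply pow_incr. split; [lra|].
    rewrite pow_add, pow_mult. apply Rmult_le_compat; try lra.
    apply pow_incr. lra. }
  replace ((1 / 4) ^ X) with ((1 / 2) ^ (2 * X))
    by (rewrite pow_mult; f_equal; field).
  assert (H2 : (1 / 2) ^ (2 * X) <= (1 / 2) ^ (k + 3 + (7 + (7 + 2 * k) * D)))
    by (apply half_pow_mono; lia).
  set (n := ((7 + 2 * k) * D)%nat) in *.
  rewrite !pow_add in H2.
  assert (E : (1 / 2) ^ n * 2 ^ n = 1).
  { rewrite <- Rpow_mult_distr. replace (1 / 2 * 2) with 1 by field. apply pow1. }
  assert (P1 : 0 < (1 / 2) ^ n) by (apply pow_lt; lra).
  assert (P2 : 0 < 2 ^ n) by (apply pow_lt; lra).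
  assert (P3 : 0 < (1 / 2) ^ k) by (apply pow_lt; lra).
  assert (P4 : 0 <= (80 * 3 ^ k) ^ D) by (apply pow_le; lra).
  assert (P5 : 0 < (1 / 2) ^ (2 * X)) by (apply pow_lt; lra).
  rewrite pow_add.
  assert (H3 : (1 / 2) ^ (2 * X) * (80 * 3 ^ k) ^ D <=
    (1 / 2) ^ k * (1 / 2) ^ 3 * ((1 / 2) ^ 7 * (1 / 2) ^ n) * 2 ^ n)
    by (apply Rmult_le_compat; lra).
  replace ((1 / 2) ^ k * (1 / 2) ^ 3 * ((1 / 2) ^ 7 * (1 / 2) ^ n) * 2 ^ n) with
    ((1 / 2) ^ k * (1 / 2) ^ 3 * (1 / 2) ^ 7 * ((1 / 2) ^ n * 2 ^ n)) in H3 by ring.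
  rewrite E in H3. simpl in *. lra.
Qed.

Lemma refinements_eta (k : nat) : 3 * (1 / 4) ^ (2 ^ refinements k) <= 1.
Proof.
  assert (H : (1 <= 2 ^ refinements k)%nat)
    by (assert (H := Nat.pow_nonzero 2 (refinements k)); lia).
  destruct (2 ^ refinements k)%nat as [|n]; [lia|]. simpl.
  assert (H1 := pow_incr (1 / 4) 1 n ltac:(lra)). rewrite pow1 in H1. lra.
Qed.

Lemma node_minus (k : nat) (i j i' j' : Z) :
  (node k i j - node k i' j')%C = node k (i - i') (j - j').
Proof.
  unfold node. rewrite !minus_IZR. apply injective_projections; simpl; ring.
Qed.

(** On the square around [node k i j] only the term of the sum with these indices is not
    negligible. *)
Lemma tower_copy (k : nat) (z : C) (i j : Z) : in_square k z ->
  (-1 <= i <= 1)%Z -> (-1 <= j <= 1)%Z ->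
  Cmod (tower (S k) (z + node k i j) - tower k z) <= (1 / 2) ^ (k + 3).
Proof.
  intros [Hx Hy] Hi Hj.
  assert (P := pitch_ge_4 k).
  set (eta := (1 / 4) ^ (2 ^ refinements k)).
  assert (Heta : 0 < eta) by (apply pow_lt; lra).
  set (h := fun i' j' : Z => (RtoC (delta0 (i - i') (j - j')) * tower k z)%C).
  assert (Hh : sum3 (fun i' => sum3 (h i')) = tower k z).
  { unfold sum3, h, delta0.
    assert (Hi' : i = (-1)%Z \/ i = 0%Z \/ i = 1%Z) by lia.
    assert (Hj' : j = (-1)%Z \/ j = 0%Z \/ j = 1%Z) by lia.
    destruct Hi' as [->|[->| ->]]; destruct Hj' as [->|[->| ->]];
      cbn [Z.sub Z.add Z.opp Z.eqb Z.pos_sub Pos.add Pos.succ andb]; ring. }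
  rewrite <- Hh at 1. cbn [tower].
  eapply Rle_trans; [|apply (refinements_enough k)]. fold eta.
  replace (9 * (9 * eta * (80 * 3 ^ k) ^ tower_degree k)) with
    (3 * (3 * (9 * eta * (80 * 3 ^ k) ^ tower_degree k))) by ring.
  apply sum3_close. intros i' Hi'. apply sum3_close. intros j' Hj'.
  assert (Hu : (z + node k i j - node k i' j')%C = (z + node k (i - i') (j - j'))%C)
    by (rewrite <- node_minus; ring).
  rewrite Hu. set (u := (z + node k (i - i') (j - j'))%C).
  assert (Htile : Cmod (tile k u - RtoC (delta0 (i - i') (j - j'))) <= 9 * eta).
  { replace u with ((fst z + IZR (i - i') * pitch k, snd z + IZR (j - j') * pitch k) : C)
      by reflexivity.
    apply bump_grid; try assumption; try lia; try lra.
    - rewrite INR_moves. lra.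
    - apply refinements_eta. }
  assert (E : h i' j' = (RtoC (delta0 (i - i') (j - j')) * tower k u)%C).
  { unfold h. unfold delta0.
    destruct (Z.eqb_spec (i - i') 0) as [Ei|Ei];
    destruct (Z.eqb_spec (j - j') 0) as [Ej|Ej]; simpl; try ring.
    unfold u. rewrite Ei, Ej, node_0, Cplus_0_r. reflexivity. }
  rewrite E.
  replace (tile k u * tower k u - RtoC (delta0 (i - i') (j - j')) * tower k u)%C with
    ((tile k u - RtoC (delta0 (i - i') (j - j'))) * tower k u)%C by ring.
  rewrite Cmod_mult. apply Rmult_le_compat; try apply Cmod_ge_0; [assumption|].
  apply tower_growth.
  assert (Hu5 : Cmod u <= 5 * pitch k).
  { unfold u. destruct z as [x y]. simpl in Hx, Hy. unfold node.
    eapply Rle_trans;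
      [apply (Cmod_Rabs_le (x + IZR (i - i') * pitch k) (y + IZR (j - j') * pitch k))|].
    assert (A1 : -2 <= IZR (i - i') <= 2) by (split; apply IZR_le; lia).
    assert (A2 : -2 <= IZR (j - j') <= 2) by (split; apply IZR_le; lia).
    apply Rabs_le_between in Hx, Hy.
    assert (Rabs (x + IZR (i - i') * pitch k) <= 5 / 2 * pitch k) by (apply Rabs_le; nra).
    assert (Rabs (y + IZR (j - j') * pitch k) <= 5 / 2 * pitch k) by (apply Rabs_le; nra).
    lra. }
  unfold pitch in Hu5. lra.
Qed.

Lemma in_square_node (k : nat) (z : C) (i j : Z) : in_square k z ->
  (-1 <= i <= 1)%Z -> (-1 <= j <= 1)%Z -> in_square (S k) (z + node k i j)%C.
Proof.
  intros [Hx Hy] [Hi1 Hi2] [Hj1 Hj2]. apply IZR_le in Hi1, Hi2, Hj1, Hj2.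
  assert (P := pitch_ge_4 k). unfold in_square. rewrite pitch_S. simpl.
  apply Rabs_le_between in Hx, Hy.
  split; apply Rabs_le; nra.
Qed.

Lemma in_square_S (k : nat) (z : C) : in_square k z -> in_square (S k) z.
Proof.
  intros Hz. rewrite <- (Cplus_0_r z), <- (node_0 k).
  apply in_square_node; lia || assumption.
Qed.

Lemma in_square_add (k n : nat) (z : C) : in_square k z -> in_square (k + n) z.
Proof.
  intros Hz. induction n as [|n IH]; [now rewrite Nat.add_0_r|].
  rewrite Nat.add_succ_r. now apply in_square_S.
Qed.

Lemma disk_in_square (r : R) : exists k, forall n z, Cmod z <= r -> in_square (k + n) z.
Proof.
  destruct (INR_unbounded r) as [k Hk]. exists k. intros n z Hz.
  assert (H : r <= pitch (k + n) / 2 - 1).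
  { assert (H := le_INR _ _ (le_pow3 (k + n))). rewrite INR_pow3, plus_INR in H.
    assert (H1 := pow3_ge_1 (k + n)). assert (H2 := pos_INR n). unfold pitch. lra. }
  split; eapply Rle_trans; [apply Rabs_fst_le_Cmod| lra | apply Rabs_snd_le_Cmod | lra].
Qed.

Lemma tower_S_close (k : nat) (z : C) : in_square k z ->
  Cmod (tower (S k) z - tower k z) <= (1 / 2) ^ (k + 3).
Proof.
  intros Hz. assert (H := tower_copy k z 0 0 Hz ltac:(lia) ltac:(lia)).
  now rewrite node_0, Cplus_0_r in H.
Qed.

Lemma tower_close (k n : nat) (z : C) : in_square k z ->
  Cmod (tower (k + n) z - tower k z) <= (1 / 2) ^ (k + 2) - (1 / 2) ^ (k + n + 2).
Proof.
  intros Hz. induction n as [|n IH].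
  - rewrite Nat.add_0_r. replace (tower k z - tower k z)%C with (RtoC 0) by ring.
    rewrite Cmod_0. lra.
  - assert (H := tower_S_close (k + n) z (in_square_add k n z Hz)).
    rewrite Nat.add_succ_r.
    replace (tower (S (k + n)) z - tower k z)%C with
      ((tower (S (k + n)) z - tower (k + n) z) + (tower (k + n) z - tower k z))%C by ring.
    eapply Rle_trans; [apply Cmod_triangle|].
    replace ((1 / 2) ^ (k + n + 3)) with ((1 / 2) ^ (k + n + 2) * (1 / 2)) in H
      by (rewrite !pow_add; simpl; field).
    replace ((1 / 2) ^ (S (k + n) + 2)) with ((1 / 2) ^ (k + n + 2) * (1 / 2))
      by (replace (S (k + n) + 2)%nat with (k + n + 2 + 1)%nat by lia;
          rewrite (pow_add _ (k + n + 2)); simpl; field).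
    lra.
Qed.

Lemma half_pow_pos (n : nat) : 0 < (1 / 2) ^ n.
Proof. apply pow_lt. lra. Qed.

Lemma half_pow_lt (eps : R) : 0 < eps -> exists n, forall k, (1 / 2) ^ (n + k) < eps.
Proof.
  intros He. destruct (half_pow_small 1 eps He) as [n Hn]. exists n. intros k.
  assert (H := half_pow_mono n (n + k) ltac:(lia)). lra.
Qed.

Lemma Cauchy_crit_tail (u : nat -> R) (k : nat) :
  (forall n m, Rabs (u (k + n + m)%nat - u (k + n)%nat) <= (1 / 2) ^ (k + n + 2)) ->
  exists l, Un_cv u l.
Proof.
  intros H. destruct (Rcomplete.R_complete u) as [l Hl]; [|now exists l].
  intros eps He. destruct (half_pow_lt (eps / 2)) as [n Hn]; [lra|].
  exists (k + n)%nat. intros a b Ha Hb.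
  assert (H1 := H n (a - (k + n))%nat). assert (H2 := H n (b - (k + n))%nat).
  replace (k + n + (a - (k + n)))%nat with a in H1 by lia.
  replace (k + n + (b - (k + n)))%nat with b in H2 by lia.
  assert (H3 := Hn (k + 2)%nat).
  replace (n + (k + 2))%nat with (k + n + 2)%nat in H3 by lia.
  unfold Rdist. replace (u a - u b) with
    ((u a - u (k + n)%nat) + - (u b - u (k + n)%nat)) by ring.
  eapply Rle_lt_trans; [apply Rabs_triang|]. rewrite Rabs_Ropp. lra.
Qed.

(** A geometric series: the errors from level [k] on add up to [(1 / 2) ^ (k + 2)]. *)
Lemma tower_limit : exists F : C -> C, forall k z, in_square k z ->
  Cmod (F z - tower k z) <= (1 / 2) ^ (k + 2).
Proof.
  assert (Hpt : forall z, exists L : C, forall k, in_square k z ->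
    Cmod (L - tower k z) <= (1 / 2) ^ (k + 2)).
  { intros z. destruct (disk_in_square (Cmod z)) as [k0 Hk0].
    assert (Hclose : forall n m, Cmod (tower (k0 + n + m) z - tower (k0 + n) z) <=
      (1 / 2) ^ (k0 + n + 2)).
    { intros n m. eapply Rle_trans.
      - apply tower_close. apply Hk0. lra.
      - assert (H := half_pow_pos (k0 + n + m + 2)). lra. }
    destruct (Cauchy_crit_tail (fun n => fst (tower n z)) k0) as [a Ha].
    { intros n m. eapply Rle_trans; [|apply (Hclose n m)].
      apply (Rabs_fst_le_Cmod (tower (k0 + n + m) z - tower (k0 + n) z)). }
    destruct (Cauchy_crit_tail (fun n => snd (tower n z)) k0) as [b Hb].
    { intros n m. eapply Rle_trans; [|apply (Hclose n m)].
      apply (Rabs_snd_le_Cmod (tower (k0 + n + m) z - tower (k0 + n) z)). }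
    exists (a, b). intros k Hk. apply Rle_plus_epsilon. intros eps He.
    destruct (Ha (eps / 2)) as [n1 Hn1]; [lra|].
    destruct (Hb (eps / 2)) as [n2 Hn2]; [lra|].
    set (n := (n1 + n2)%nat).
    specialize (Hn1 (k + n)%nat ltac:(lia)). specialize (Hn2 (k + n)%nat ltac:(lia)).
    unfold Rdist in Hn1, Hn2.
    assert (H1 := tower_close k n z Hk). assert (H2 := half_pow_pos (k + n + 2)).
    assert (H3 : Cmod ((a, b) - tower (k + n) z) <= eps).
    { rewrite Cmod_minus_sym. destruct (tower (k + n) z) as [x y].
      eapply Rle_trans; [apply (Cmod_Rabs_le (x - a) (y - b))|]. simpl in *. lra. }
    replace ((a, b) - tower k z)%C with
      (((a, b) - tower (k + n) z) + (tower (k + n) z - tower k z))%C by ring.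
    eapply Rle_trans; [apply Cmod_triangle|]. lra. }
  exists (fun z => proj1_sig (constructive_indefinite_description _ (Hpt z))).
  intros k z Hk. exact (proj2_sig (constructive_indefinite_description _ (Hpt z)) k Hk).
Qed.

Lemma nearby_multiple (x p : R) : 0 < p -> exists i : Z, Rabs (IZR i * p - x) <= p.
Proof.
  intros Hp. exists (up (x / p)). destruct (archimed (x / p)) as [H1 H2].
  assert (E : x = x / p * p) by (field; lra). rewrite E at 2.
  apply Rabs_le. split; nra.
Qed.

Lemma level_of_radius (t : R) : 1 <= t -> exists k : nat,
  pitch k / 2 - 1 <= t <= pitch (S k) / 2 - 1.
Proof.
  intros Ht.
  assert (H : forall N, t <= pitch N / 2 - 1 -> exists k : nat,
    pitch k / 2 - 1 <= t <= pitch (S k) / 2 - 1).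
  { induction N as [|N IH]; intros HN.
    - exists 0%nat. unfold pitch in *. simpl in *. lra.
    - destruct (Rle_dec t (pitch N / 2 - 1)) as [H|H]; [now apply IH|].
      exists N. lra. }
  destruct (disk_in_square t) as [N HN]. apply (H (N + 0)%nat).
  destruct (HN 0%nat (RtoC t)) as [H1 _].
  - rewrite Cmod_R, Rabs_pos_eq; lra.
  - simpl in H1. rewrite Rabs_pos_eq in H1; lra.
Qed.

Lemma ln_nonpos (x : R) : x <= 0 -> ln x = 0.
Proof. intros H. unfold ln. destruct (Rlt_dec 0 x); [exfalso; lra | reflexivity]. Qed.

Lemma ln_le_id (x : R) : 0 < x -> ln x <= x.
Proof.
  intros Hx. destruct (Rle_dec x 1) as [H|H].
  - apply ln_le in H; [|assumption]. rewrite ln_1 in H. lra.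
  - assert (H1 := exp_ineq1_le x).
    assert (H2 : ln x <= ln (exp x)) by (apply ln_le; lra). now rewrite ln_exp in H2.
Qed.

Section Limit.

Variable F : C -> C.
Hypothesis HF : forall k z, in_square k z -> Cmod (F z - tower k z) <= (1 / 2) ^ (k + 2).

Lemma limit_entire (z : C) : cdiff F z.
Proof.
  apply weierstrass. intros r eps He.
  destruct (disk_in_square r) as [k Hk]. destruct (half_pow_lt eps He) as [n Hn].
  exists (tower (k + n)). split; [apply cdiff_tower|].
  intros y Hy. rewrite Cmod_minus_sym.
  eapply Rle_trans; [apply HF, Hk, Hy|].
  specialize (Hn (k + 2)%nat). replace (n + (k + 2))%nat with (k + n + 2)%nat in Hn by lia.
  lra.
Qed.

Lemma limit_non_constant : non_constant F.
Proof.
  intros [c Hc].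
  assert (H0 := HF 0 0%C). assert (H1 := HF 0 1%C). rewrite Hc in H0, H1.
  simpl tower in H0, H1.
  assert (S0 : in_square 0 0%C).
  { unfold in_square, pitch; simpl. rewrite Rabs_R0. lra. }
  assert (S1 : in_square 0 1%C).
  { unfold in_square, pitch; simpl. rewrite Rabs_R0, Rabs_R1. lra. }
  specialize (H0 S0). specialize (H1 S1).
  assert (H := Cmod_triangle_minus (c - 0) (c - 1)).
  replace (c - 0 - (c - 1))%C with (RtoC 1) in H by ring.
  rewrite Cmod_1 in H. simpl in H0, H1. lra.
Qed.

(** Balanced ternary expansion of the indices: the first digit is a translation as in
    [tower_copy], and the others are nodes of the next level. *)
Lemma limit_translate (n : nat) : forall k i j z, (Z.abs i + Z.abs j <= Z.of_nat n)%Z ->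
  in_square k z -> Cmod (F (z + node k i j)%C - tower k z) <= (1 / 2) ^ (k + 2).
Proof.
  induction n as [|n IH]; intros k i j z Hn Hz.
  - replace i with 0%Z by lia. replace j with 0%Z by lia.
    rewrite node_0, Cplus_0_r. now apply HF.
  - destruct (Z.eq_dec (Z.abs i + Z.abs j) 0) as [E|E].
    + replace i with 0%Z by lia. replace j with 0%Z by lia.
      rewrite node_0, Cplus_0_r. now apply HF.
    + set (i' := ((i + 1) / 3)%Z). set (j' := ((j + 1) / 3)%Z).
      set (r := (i - 3 * i')%Z). set (s := (j - 3 * j')%Z).
      assert (Hr : (-1 <= r <= 1)%Z).
      { unfold r, i'. assert (H := Z.div_mod (i + 1) 3 ltac:(lia)).
        assert (H1 := Z.mod_pos_bound (i + 1) 3 ltac:(lia)). lia. }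
      assert (Hs : (-1 <= s <= 1)%Z).
      { unfold s, j'. assert (H := Z.div_mod (j + 1) 3 ltac:(lia)).
        assert (H1 := Z.mod_pos_bound (j + 1) 3 ltac:(lia)). lia. }
      assert (Hnode : node k i j = (node k r s + node (S k) i' j')%C).
      { unfold node. rewrite pitch_S.
        replace i with (r + 3 * i')%Z by (unfold r; lia).
        replace j with (s + 3 * j')%Z by (unfold s; lia).
        rewrite !plus_IZR, !mult_IZR. apply injective_projections; simpl.
        - replace (r + 3 * i' - 3 * i')%Z with r by lia. ring.
        - ring. }
      rewrite Hnode.
      replace (z + (node k r s + node (S k) i' j'))%C with
        ((z + node k r s) + node (S k) i' j')%C by ring.
      assert (H1 := IH (S k) i' j' (z + node k r s)%C ltac:(lia)
        (in_square_node k z r s Hz Hr Hs)).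
      assert (H2 := tower_copy k z r s Hz Hr Hs).
      replace (F (z + node k r s + node (S k) i' j')%C - tower k z)%C with
        ((F (z + node k r s + node (S k) i' j')%C - tower (S k) (z + node k r s)%C) +
         (tower (S k) (z + node k r s)%C - tower k z))%C by ring.
      eapply Rle_trans; [apply Cmod_triangle|].
      replace (S k + 2)%nat with (k + 2 + 1)%nat in H1 by lia.
      replace (k + 3)%nat with (k + 2 + 1)%nat in H2 by lia.
      rewrite pow_add, pow_1 in H1, H2. lra.
Qed.

Lemma limit_recurrent : locally_uniformly_recurrent F.
Proof.
  intros eps K He HK.
  destruct (compact_bounded K HK) as [r Hr].
  destruct (disk_in_square r) as [k0 Hk0].
  destruct (half_pow_lt eps He) as [n Hn].
  set (k := (k0 + n)%nat).
  assert (Hsmall : (1 / 2) ^ k < eps).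
  { unfold k. rewrite Nat.add_comm. apply Hn. }
  assert (P := pitch_ge_4 k).
  exists (2 * pitch k). split; [lra|]. intros c rad Hrad.
  destruct (nearby_multiple (fst c) (pitch k)) as [i Hi]; [lra|].
  destruct (nearby_multiple (snd c) (pitch k)) as [j Hj]; [lra|].
  exists (node k i j). split.
  - apply Rle_lt_trans with ((1 / 2) ^ k); [|assumption].
    apply max_on_le; [apply Rlt_le, half_pow_pos|].
    intros z Hz. assert (Hsq : in_square k z) by (apply Hk0, Hr, Hz).
    assert (H1 := limit_translate (Z.to_nat (Z.abs i + Z.abs j)) k i j z
      ltac:(lia) Hsq).
    assert (H2 := HF k z Hsq).
    unfold translate.
    replace (F (z + node k i j)%C - F z)%C with
      ((F (z + node k i j)%C - tower k z) - (F z - tower k z))%C by ring.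
    eapply Rle_trans; [apply Cmod_triangle_minus|].
    rewrite pow_add in H1, H2. simpl in H1, H2.
    assert (H3 := half_pow_pos k). lra.
  - unfold closed_disk. eapply Rle_trans;
      [apply (Cmod_Rabs_le (IZR i * pitch k - fst c) (IZR j * pitch k - snd c))|]. lra.
Qed.

(** [ln (ln (X ^ D)) = ln D + ln (ln X)], here with [D = 3 ^ (750 * q)], [X = 372 * q] and
    [q = 3 ^ k <= t]. *)
Lemma limit_growth (t : R) : 1 < t -> loglog_rate F t <= 1872.
Proof.
  intros Ht. destruct (level_of_radius t) as [k [Hk1 Hk2]]; [lra|].
  set (q := 3 ^ k). assert (Hq : 1 <= q) by apply pow3_ge_1.
  unfold pitch in Hk1, Hk2. rewrite <- tech_pow_Rmult in Hk2. fold q in Hk1, Hk2.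
  set (D := tower_degree (S k)).
  assert (HD : (1 <= D)%nat) by apply tower_degree_pos.
  assert (Hlow : 0 <= 1872 * q) by lra.
  assert (Hcont : forall z, ccont F z) by (intros; apply cdiff_ccont, limit_entire).
  assert (HM : max_modulus F t <= (372 * q) ^ D).
  { apply max_modulus_le; [apply pow_le; lra|]. intros z Hz.
    assert (Hsq : in_square (S k) z).
    { unfold in_square, pitch. rewrite <- tech_pow_Rmult. fold q.
      split; eapply Rle_trans;
        [apply Rabs_fst_le_Cmod | lra | apply Rabs_snd_le_Cmod | lra]. }
    assert (H1 := HF (S k) z Hsq).
    assert (H2 := tower_growth (S k) z (186 * q)).
    rewrite <- tech_pow_Rmult in H2. fold q in H2. specialize (H2 ltac:(lra)).
    fold D in H2.
    assert (H3 := pow_incr (1 / 2) 1 (S k + 2) ltac:(lra)). rewrite pow1 in H3.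
    assert (H4 := Cmod_triangle (F z - tower (S k) z) (tower (S k) z)).
    replace (F z - tower (S k) z + tower (S k) z)%C with (F z) in H4 by ring.
    replace (372 * q) with (2 * (186 * q)) by ring. rewrite Rpow_mult_distr.
    assert (H5 : 2 ^ 1 <= 2 ^ D) by (apply Rle_pow; [lra | assumption]).
    rewrite pow_1 in H5.
    assert (H6 : 1 <= (186 * q) ^ D) by (apply pow_R1_Rle; lra).
    nra. }
  assert (HV : ln (ln (max_modulus F t)) <= 1872 * q).
  { destruct (Rle_dec (max_modulus F t) 0) as [H0|H0].
    { rewrite (ln_nonpos _ H0), (ln_nonpos 0); lra. }
    apply ln_le in HM; [|lra]. rewrite ln_pow in HM by lra.
    destruct (Rle_dec (ln (max_modulus F t)) 0) as [H1|H1].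
    { rewrite (ln_nonpos _ H1); lra. }
    apply ln_le in HM; [|lra].
    assert (Hl : 0 < ln (372 * q)) by (rewrite <- ln_1; apply ln_increasing; lra).
    assert (HD' : 0 < INR D) by (apply lt_0_INR; lia).
    rewrite ln_mult in HM by assumption.
    assert (HlnD : ln (INR D) <= 1500 * q).
    { unfold D, tower_degree. rewrite pow_INR.
      rewrite ln_pow by (simpl; lra).
      rewrite mult_INR, INR_pow3, <- tech_pow_Rmult. fold q.
      rewrite (INR_IZR_INZ 250), (INR_IZR_INZ 3). simpl IZR.
      assert (Hln3 : ln 3 <= 2).
      { assert (H := exp_ineq1_le 2). assert (H2 : ln 3 <= ln (exp 2))
          by (apply ln_le; lra). now rewrite ln_exp in H2. }
      nra. }
    assert (Hll : ln (ln (372 * q)) <= 372 * q).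
    { eapply Rle_trans; [apply ln_le_id; assumption|]. apply ln_le_id. lra. }
    lra. }
  unfold loglog_rate. apply (Rmult_le_reg_r t); [lra|].
  unfold Rdiv. rewrite Rmult_assoc, Rinv_l by lra. lra.
Qed.

End Limit.

(** * Growth of recurrent entire functions *)

Theorem theorem2 :
  (forall F : C -> C,
     entire F -> non_constant F -> locally_uniformly_recurrent F ->
     Rbar_lt 0 (LimInf_infty (loglog_rate F))) /\
  (exists F : C -> C,
     entire F /\ non_constant F /\ locally_uniformly_recurrent F /\
     Rbar_lt (LimSup_infty (loglog_rate F)) p_infty).
Proof.
  split.
  - intros F HF Hnc Hrec.
    destruct (recurrent_growth_lower_bound F) as (l & T & Hl & HT);
      [intros z; apply ex_derive_cdiff, HF | assumption | assumption |].
    apply Rbar_lt_le_trans with (Finite l); [exact Hl|].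
    exact (LimInf_infty_ge _ T l HT).
  - destruct tower_limit as [F HF]. exists F. repeat split.
    + intros z. apply ex_derive_cdiff, (limit_entire F HF).
    + exact (limit_non_constant F HF).
    + exact (limit_recurrent F HF).
    + apply Rbar_le_lt_trans with (Finite 1872); [|exact I].
      exact (LimSup_infty_le _ 1 1872 (limit_growth F HF)).
Qed.
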